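(* Let $n$ be a positive integer, let $m$ be a nonzero integer, put $r=|m|$ and $k_0=n$. Let $X_m$ be the element of the $A_2$ web space of the disk represented by $|m|$ half twists of two ribbons of $n$ parallel strands each, the two ribbons having the same direction, with a clasp $P_n$ of type $(n,0)$ at each of the four ends; the crossings are positive if $m>0$ and negative if $m<0$. Let $D_k$ ($0\le k\le n$) be the crossingless web described in the context. Then, if $m>0$, $$X_m=\sum_{0\le k_m\le k_{m-1}\le\cdots\le k_1\le n}\chi_1(n,k_1,\dots,k_m)\,D_{k_m},$$ where $$\chi_1(n,k_1,\dots,k_m)=(-1)^{nm}\frac{q^{-\frac16(n^2+3n)m}q^{\frac12(n-k_m)}(-1)^{\sum_{i=1}^mk_i}q^{\sum_{i=1}^m\frac12(k_i^2+k_i)}(q)_n}{\prod_{i=1}^m(q)_{k_{i-1}-k_i}\,(q)_{k_m}};$$ and if $m<0$, with $r=|m|$, $$X_m=\sum_{0\le k_r\le k_{r-1}\le\cdots\le k_1\le n}\chi_{-1}(n,k_1,\dots,k_r)\,D_{k_r},$$ where $$\chi_{-1}(n,k_1,\dots,k_r)=(-1)^{nr}\frac{q^{\frac16(n^2+3n)r}q^{-\frac12(n-k_r)}(-1)^{\sum_{i=1}^rk_i}q^{\sum_{i=1}^r\frac12(k_i^2-k_i)}q^{-\sum_{i=1}^rk_{i-1}k_i}(q)_n}{\prod_{i=1}^r(q)_{k_{i-1}-k_i}\,(q)_{k_r}}.$$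
   Context: Notation. $(q)_k=\prod_{i=1}^k(1-q^i)$, $(q)_0=1$, $[n]_q=\frac{q^{n/2}-q^{-n/2}}{q^{1/2}-q^{-1/2}}$. $A_2$ web space. Fix a disk with signed marked points on its boundary. A web is an oriented planar graph in the disk whose interior vertices are trivalent sinks or sources and whose univalent vertices are the marked points (closed loops allowed). The $A_2$ web space is the $\mathbb{Q}(q^{1/6})$-vector space spanned by webs (up to boundary-fixing isotopy), modulo the local relations: a square face is replaced by the sum of the two ways of joining its four legs in adjacent pairs by two disjoint arcs; a bigon face is replaced by $[2]_q$ times an edge; a disjoint circle is replaced by $[3]_q$. (A basis is given by webs with no internal $0$-, $2$- or $4$-gons.) Diagrams with crossings represent elements via (positive crossing) $=q^{1/3}$(oriented smoothing)$-q^{-1/6}H$ and (negative crossing) $=q^{-1/3}$(oriented smoothing)$-q^{1/6}H$, where, with both strands drawn upward, $H$ is the web in which the two incoming bottom strands end at a lower sink vertex, the two outgoing top strands leave an upper source vertex, and a middle edge runs from the source down to the sink. Clasp. For $n$ upward strands, $P_1$ is the strand and $P_n=(P_{n-1}\otimes 1)-\frac{[n-1]_q}{[n]_q}(P_{n-1}\otimes1)(1_{n-2}\otimes H)(P_{n-1}\otimes 1)$ ($\otimes$ juxtaposition, product vertical composition). Triangle web $T_j$. Subdivide a triangle of side $j$ into $j^2$ small unit triangles and take the dual graph: one trivalent vertex per small triangle, edges crossing the sides of the small triangles, so that $j$ legs leave through each of the three sides. All $3j$ legs are oriented inward (or, for the opposite type, all outward), which makes every vertex a sink or a source. $T_0$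 is empty. The web $D_k$. Draw the two ribbons going upward, with $n$ left and $n$ right strands, and a clasp $P_n$ at the bottom and at the top of each ribbon. In $D_k$ the leftmost $k$ of the left strands and the rightmost $k$ of the right strands go straight from the bottom clasps to the top clasps; the remaining $n-k$ strands of the left bottom clasp and $n-k$ strands of the right bottom clasp enter two sides of an inward-oriented $T_{n-k}$; its third side is joined by $n-k$ parallel edges to one side of an outward-oriented $T_{n-k}$ above it, whose two other sides are joined to the remaining $n-k$ strands of the left top clasp and of the right top clasp. Thus $D_n$ is two clasped ribbons going straight up, and for $n=1$, $D_0=H$. *)

(* Defs.v *)
(* MathComp; the free vector space on words comes from multinomials' monalg,
   and boolp is used only to decide membership in the subspace of relations. *)
From HB Require Import structures.
From mathcomp Require Import all_boot all_order all_algebra.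
From mathcomp Require Import generic_quotient ring_quotient.
From mathcomp Require Import boolp.
From mathcomp.multinomials Require Import monalg.

Set Implicit Arguments.
Unset Strict Implicit.
Unset Printing Implicit Defensive.

Import GRing.Theory Num.Theory.
Local Open Scope ring_scope.
Local Open Scope quotient_scope.

(* The field Q(q^(1/6)); the indeterminate of {poly rat} is q^(1/6). *)
Definition K : fieldType := {fraction {poly rat}}.

(* q6 e = q^(e/6); in particular q^(1/2) = q6 3 and q = q6 6. *)
Definition q6 (e : int) : K := (tofrac ('X : {poly rat}) : K) ^ e.

Definition qint (n : nat) : K :=
  (q6 (3 * n%:Z) - q6 (- (3 * n%:Z))) / (q6 3 - q6 (- 3)).

Definition qpoch (k : nat) : K := \prod_(1 <= i < k.+1) (1 - q6 6 ^+ i).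

(* Webs.  The disk is a rectangle, with its marked points on the bottom and top
   sides.  A web in generic position with respect to the height function is
   recorded by the signs of its bottom points (true: the edge is oriented
   upward there; false: downward) and by the list, from bottom to top, of its
   critical levels.  The level (i, g) has exactly i strands to the left of the
   elementary piece g; every other strand is vertical there. *)
Inductive piece :=
  | Cup of bool    (* local minimum of an edge:  [::]     -> [:: s; ~~ s] *)
  | Cap of bool    (* local maximum of an edge:  [:: s; ~~ s] -> [::] *)
  | Merge of bool  (* vertex, two edges below:   [:: s; s] -> [:: ~~ s] *)
  | Split of bool. (* vertex, two edges above:   [:: s] -> [:: ~~ s; ~~ s] *)

(* Merge s and Split s are sinks if s = true and sources if s = false. *)
Definition bot (g : piece) : seq bool :=
  match g with
  | Cup _ => [::] | Cap s => [:: s; ~~ s]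
  | Merge s => [:: s; s] | Split s => [:: s]
  end.

Definition top (g : piece) : seq bool :=
  match g with
  | Cup s => [:: s; ~~ s] | Cap _ => [::]
  | Merge s => [:: ~~ s] | Split s => [:: ~~ s; ~~ s]
  end.

Definition piece_code (g : piece) : bool * bool * bool :=
  match g with
  | Cup s => (false, false, s) | Cap s => (false, true, s)
  | Merge s => (true, false, s) | Split s => (true, true, s)
  end.

Definition piece_decode (c : bool * bool * bool) : piece :=
  match c with
  | (false, false, s) => Cup s | (false, true, s) => Cap s
  | (true, false, s) => Merge s | (true, true, s) => Split s
  end.

Lemma piece_codeK : cancel piece_code piece_decode.
Proof. by case. Qed.

HB.instance Definition _ := Countable.copy piece (can_type piece_codeK).

Definition word := seq (nat * piece).

HB.instance Definition _ := Choice.on word.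

Lemma word_unit (u v : word) : u ++ v = [::] -> u = [::] /\ v = [::].
Proof. by case: u. Qed.

HB.instance Definition _ := Choice_isMonomialDef.Build word
  (@catA _) (@cat0s _) (@cats0 _) word_unit.

Definition step (a : seq bool) (e : nat * piece) : option (seq bool) :=
  let: (i, g) := e in
  if (i <= size a)%N && (take (size (bot g)) (drop i a) == bot g)
  then Some (take i a ++ top g ++ drop (i + size (bot g)) a) else None.

(* The signs at the top of w when those at the bottom are a. *)
Definition run (a : seq bool) (w : word) : option (seq bool) :=
  foldl (fun o e => obind (step^~ e) o) (Some a) w.

Definition is_web (a b : seq bool) (w : word) : bool := run a w == Some b.

Lemma run_cat a u v : run a (u ++ v) = obind (run^~ v) (run a u).
Proof.
rewrite /run foldl_cat; case: (foldl _ _ u) => //=.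
by elim: v => //= e v; rewrite /run /=.
Qed.

Lemma run_cons a e w : run a (e :: w) = obind (run^~ w) (step a e).
Proof. by rewrite -cat1s run_cat /run /=. Qed.

Lemma is_web_cat a b c u v : is_web a b u -> is_web b c v -> is_web a c (u ++ v).
Proof. by rewrite /is_web run_cat => /eqP -> /= ->. Qed.

Lemma step_piece x g y i :
  i = size x -> step (x ++ bot g ++ y) (i, g) = Some (x ++ top g ++ y).
Proof.
move=> ->; rewrite /step size_cat leq_addr /= drop_size_cat // take_size_cat //.
by rewrite take_size_cat // eqxx addnC -drop_drop !drop_size_cat.
Qed.

Lemma stepP a b i g : step a (i, g) = Some b ->
  exists x y, [/\ a = x ++ bot g ++ y, b = x ++ top g ++ y & size x = i].
Proof.
rewrite /step; case: ifP => // /andP[hi /eqP hb] [<-].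
exists (take i a), (drop (i + size (bot g)) a); split=> //.
  by rewrite -{1}hb addnC -drop_drop cat_take_drop cat_take_drop.
by rewrite size_take_min (minn_idPl hi).
Qed.

Definition shift (i : nat) (w : word) : word :=
  [seq ((i + e.1)%N, e.2) | e <- w].

Lemma is_web_shift x y a b w :
  is_web a b w -> is_web (x ++ a ++ y) (x ++ b ++ y) (shift (size x) w).
Proof.
rewrite /is_web; elim: w a => [|[i g] w IHw] a /= => [/eqP[->]|] //.
rewrite /shift /= -/(shift _ _) !run_cons.
case E: (step a (i, g)) => [c|] // /IHw; have [u [v [-> -> <-]]] := stepP E.
have := @step_piece (x ++ u) g (v ++ y) (size x + size u).
by rewrite size_cat -!catA => -> //.
Qed.

(* Boundary-fixing isotopy of webs in generic position is generated by:
   exchanging the heights of two pieces lying side by side, cancelling a minimum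
   against an adjacent maximum, and turning a leg of a vertex over.
   isotopy p l r: l and r are words with bottom signs p. *)
Inductive isotopy : seq bool -> word -> word -> Prop :=
  | iso_exchange g h z :
      isotopy (bot g ++ z ++ bot h)
        [:: (0, g); (size (top g) + size z, h)]%N
        [:: (size (bot g) + size z, h); (0, g)]%N
  | iso_zigzag_left s :
      isotopy [:: s] [:: (1, Cup (~~ s)); (0, Cap s)]%N [::]
  | iso_zigzag_right s :
      isotopy [:: s] [:: (0, Cup s); (1, Cap (~~ s))]%N [::]
  | iso_turn_right s :
      isotopy [:: s; s] [:: (0, Split s); (1, Cap (~~ s))]%N
                        [:: (0, Merge s)]%N
  | iso_turn_left s :
      isotopy [:: s; s] [:: (1, Split s); (0, Cap s)]%N
                        [:: (0, Merge s)]%N.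

(* skein p l r: the web l with bottom signs p equals the combination r.
   The square has its legs at the four corners of the rectangle. *)
Inductive skein : seq bool -> word -> seq (K * word) -> Prop :=
  | skein_circle s :
      skein [::] [:: (0, Cup s); (0, Cap s)]%N [:: (qint 3, [::])]
  | skein_bigon s :
      skein [:: s] [:: (0, Split s); (0, Merge (~~ s))]%N [:: (qint 2, [::])]
  | skein_square s :
      skein [:: s; ~~ s]
        [:: (0, Split s); (1, Merge (~~ s)); (0, Split (~~ s)); (1, Merge s)]%N
        [:: (1, [::]); (1, [:: (0, Cap s); (0, Cup s)]%N)].

Definition local_rel (p : seq bool) (l : word) (r : seq (K * word)) : Prop :=
  (exists2 w, isotopy p l w & r = [:: (1, w)]) \/ skein p l r.

Lemma local_rel_is_web p l r : local_rel p l r ->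
  exists b, is_web p b l && all (fun cw => is_web p b cw.2) r.
Proof.
have exchange g h z (c := top g ++ z ++ top h) :
    is_web (bot g ++ z ++ bot h) c
      [:: (0, g); (size (top g) + size z, h)]%N /\
    is_web (bot g ++ z ++ bot h) c
      [:: (size (bot g) + size z, h); (0, g)]%N.
  split; rewrite /is_web !run_cons.
    rewrite (@step_piece [::]) //= run_cons catA -[bot h]cats0.
    by rewrite step_piece ?size_cat //= cats0 /run /= -catA.
  rewrite catA -[bot h]cats0 step_piece ?size_cat //= run_cons -catA.
  by rewrite (@step_piece [::]) //= cats0.
case=> [[w iso ->]|sk].
  case: iso => [g h z|s|s|s|s].
  - have [e1 e2] := exchange g h z.
    by exists (top g ++ z ++ top h); rewrite e1 /= e2.
  - by exists [:: s]; case: s.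
  - by exists [:: s]; case: s.
  - by exists [:: ~~ s]; case: s.
  - by exists [:: ~~ s]; case: s.
case: sk => s.
- by exists [::]; case: s.
- by exists [:: s]; case: s.
- by exists [:: s; ~~ s]; case: s.
Qed.

(* Formal combinations of words.  The product is concatenation, i.e. vertical
   composition, the left factor being at the bottom.  A word says nothing about
   the strands to the right of its pieces, so juxtaposition with vertical
   strands on the right leaves it unchanged, and on the left it is shift. *)
Definition comb := {malg K[word]}.
HB.instance Definition _ := GRing.Lalgebra.on comb.

Lemma comb_scalerAr (c : K) (f g : comb) : c *: (f * g) = f * (c *: g).
Proof.
rewrite -[c *: g]mul_malgC mulrA; suff -> : f * c%:MP = c *: f by rewrite scalerAl.
rewrite -mul_malgC !malgM_def fgmulgU fgmulUg; apply: eq_bigr => w _.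
by rewrite mulrC mulm1 mul1m.
Qed.

HB.instance Definition _ := GRing.Lalgebra_isAlgebra.Build K comb comb_scalerAr.

Definition web (w : word) : comb := << w >>.

(* f is a combination of webs from a to b. *)
Definition web_comb (a b : seq bool) (f : comb) : Prop :=
  exists2 s : seq (K * word),
    f = \sum_(cw <- s) cw.1 *: web cw.2 & all (fun cw => is_web a b cw.2) s.

Lemma web_comb_web a b w : is_web a b w -> web_comb a b (web w).
Proof. by exists [:: (1, w)]; rewrite ?big_seq1 ?scale1r //= andbT. Qed.

Lemma web_comb1 a : web_comb a a 1.
Proof. by apply: (@web_comb_web a a [::]); rewrite /is_web /run /=. Qed.

Lemma web_combD a b f g : web_comb a b f -> web_comb a b g -> web_comb a b (f + g).
Proof.
case=> [s -> hs] [t -> ht]; exists (s ++ t); first by rewrite big_cat.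
by rewrite all_cat hs.
Qed.

Lemma web_combZ a b c f : web_comb a b f -> web_comb a b (c *: f).
Proof.
case=> [s -> hs]; exists [seq (c * cw.1, cw.2) | cw <- s].
  by rewrite big_map scaler_sumr; apply: eq_bigr => cw _; rewrite scalerA.
by rewrite all_map.
Qed.

Lemma web_combB a b f g : web_comb a b f -> web_comb a b g -> web_comb a b (f - g).
Proof. by move=> hf hg; rewrite -scaleN1r; apply/web_combD/web_combZ. Qed.

Lemma webM u v : web u * web v = web (u ++ v).
Proof. by rewrite malgM_def fgmulUU mulr1. Qed.

Lemma web_combM a b c f g :
  web_comb a b f -> web_comb b c g -> web_comb a c (f * g).
Proof.
case=> [s -> hs] [t -> ht].
exists [seq (x.1 * y.1, x.2 ++ y.2) | x <- s, y <- t].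
  rewrite big_allpairs_dep mulr_suml; apply: eq_bigr => x _.
  rewrite mulr_sumr; apply: eq_bigr => y _ /=.
  by rewrite -scalerAl -scalerAr scalerA webM.
apply/allP=> _ /allpairsP[[x y] [/= hx hy ->]] /=.
exact: is_web_cat (allP hs _ hx) (allP ht _ hy).
Qed.

(* The relations of the web space with bottom signs a and top signs b.  A word
   that does not describe a web from a to b is itself a relation; as the local
   relations only involve words with the same boundary (local_rel_is_web), the
   quotient is the space spanned by the webs from a to b modulo isotopy and the
   skein relations. *)
Inductive web_rel (a b : seq bool) : comb -> Prop :=
  | rel_zero : web_rel a b 0
  | rel_add f g : web_rel a b f -> web_rel a b g -> web_rel a b (f + g)
  | rel_scale c f : web_rel a b f -> web_rel a b (c *: f)
  | rel_notweb w : ~~ is_web a b w -> web_rel a b (web w)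
  | rel_local u x p y v l r :
      run a u = Some (x ++ p ++ y) -> local_rel p l r ->
      web_rel a b (web (u ++ shift (size x) l ++ v)
        - \sum_(cw <- r) cw.1 *: web (u ++ shift (size x) cw.2 ++ v)).

Definition web_relb (a b : seq bool) : {pred comb} :=
  [pred f | `[< web_rel a b f >]].

Lemma web_relbP a b f : reflect (web_rel a b f) (f \in web_relb a b).
Proof. exact: asboolP. Qed.

Lemma web_rel_zmod_closed a b : zmod_closed (web_relb a b).
Proof.
split=> [|f g /web_relbP hf /web_relbP hg]; apply/web_relbP; first exact: rel_zero.
by rewrite -scaleN1r; apply: rel_add => //; apply: rel_scale.
Qed.

HB.instance Definition _ a b :=
  GRing.isZmodClosed.Build comb (web_relb a b) (web_rel_zmod_closed a b).

(* The A_2 web space of the rectangle with bottom signs a and top signs b. *)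
Definition web_space (a b : seq bool) := Quotient.quot (web_relb a b).
HB.instance Definition _ a b := Choice.on (web_space a b).
HB.instance Definition _ a b := GRing.Zmodule.on (web_space a b).

Definition web_class (a b : seq bool) (f : comb) : web_space a b :=
  \pi_(Quotient.quot (web_relb a b)) f.

Definition web_space_scale a b (c : K) (x : web_space a b) : web_space a b :=
  web_class a b (c *: (repr x : comb)).

Lemma web_classP a b f g :
  web_class a b f = web_class a b g <-> web_rel a b (f - g).
Proof.
rewrite /web_class; split.
  by move/eqP; rewrite -Quotient.idealrBE => /web_relbP.
by move=> h; apply/eqP; rewrite -Quotient.idealrBE; apply/web_relbP.
Qed.

Lemma web_class_repr a b (x : web_space a b) : web_class a b (repr x) = x.
Proof. exact: reprK. Qed.

Lemma web_class_scale a b c f :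
  web_space_scale c (web_class a b f) = web_class a b (c *: f).
Proof.
apply/web_classP; rewrite -scalerBr; apply: rel_scale.
by apply/web_classP; rewrite web_class_repr.
Qed.

Lemma web_class_add a b f g :
  web_class a b (f + g) = web_class a b f + web_class a b g.
Proof. by rewrite /web_class piE. Qed.

Section WebSpaceLmodule.
Variables a b : seq bool.
Implicit Types x y : web_space a b.

Lemma web_scaleA (c d : K) x :
  web_space_scale c (web_space_scale d x) = web_space_scale (c * d) x.
Proof. by rewrite -[x]web_class_repr !web_class_scale scalerA. Qed.

Lemma web_scale1 : left_id 1 (@web_space_scale a b).
Proof. by move=> x; rewrite -[x]web_class_repr web_class_scale scale1r. Qed.

Lemma web_scaleDr : right_distributive (@web_space_scale a b) +%R.
Proof.
move=> c x y; rewrite -[x]web_class_repr -[y]web_class_repr.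
by rewrite !(=^~ web_class_add, web_class_scale) scalerDr.
Qed.

Lemma web_scaleDl x : {morph (@web_space_scale a b)^~ x : c d / c + d}.
Proof.
move=> c d; rewrite -[x]web_class_repr.
by rewrite !(web_class_scale, =^~ web_class_add) scalerDl.
Qed.

HB.instance Definition _ := GRing.Zmodule_isLmodule.Build K (web_space a b)
  web_scaleA web_scale1 web_scaleDr web_scaleDl.

Lemma web_class_is_linear : linear (web_class a b).
Proof. by move=> c f g; rewrite web_class_add -web_class_scale. Qed.

HB.instance Definition _ := GRing.isLinear.Build K comb (web_space a b) _
  (web_class a b) web_class_is_linear.

End WebSpaceLmodule.

(* H on the upward strands i and i+1 (strands are numbered from 0). *)
Definition Hword (i : nat) : word := [:: (i, Merge true); (i, Split false)].

(* The crossing of the upward strands i and i+1, positive if pos holds. *)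
Definition crossing (pos : bool) (i : nat) : comb :=
  if pos then q6 2 *: 1 - q6 (- 1) *: web (Hword i)
  else q6 (- 2) *: 1 - q6 1 *: web (Hword i).

(* clasp i n is P_n on the strands i, ..., i + n - 1. *)
Fixpoint clasp (i n : nat) : comb :=
  match n with
  | n'.+1 =>
      if n' is n''.+1 then
        clasp i n' - (qint n' / qint n) *:
          (clasp i n' * web (Hword (i + n'')) * clasp i n')
      else 1
  | 0%N => 1
  end.

(* One half twist of two ribbons of n upward strands: the strands
   n - 1, ..., 0 of the left ribbon successively cross the whole right ribbon. *)
Definition half_twist (pos : bool) (n : nat) : comb :=
  \prod_(i < n) \prod_(j < n) crossing pos (n - i.+1 + j).

Definition clasps (n : nat) : comb := clasp 0 n * clasp n n.

Definition twist (n : nat) (m : int) : comb :=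
  clasps n * half_twist (0 < m) n ^+ `|m|%N * clasps n.

(* The triangle web T_j with inward legs, drawn with one corner of the triangle
   at the bottom, as a web from 2j upward to j downward strands.  The last line
   of small triangles is placed around T_(j-1): its j - 1 upward pointing
   triangles give Split false, then its j downward pointing ones Merge true. *)
Fixpoint triangle_in (j : nat) : word :=
  if j is j'.+1 then
    shift 1 (triangle_in j')
    ++ [seq ((i.*2).+1, Split false) | i <- iota 0 j']
    ++ [seq (i, Merge true) | i <- iota 0 j]
  else [::].

(* T_j with outward legs: the mirror image of triangle_in j in a horizontal
   line, from j downward to 2j upward strands. *)
Fixpoint triangle_out (j : nat) : word :=
  if j is j'.+1 then
    [seq (i.*2, Split false) | i <- iota 0 j]
    ++ [seq (i.+1, Merge true) | i <- iota 0 j']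
    ++ shift 1 (triangle_out j')
  else [::].

Definition stem (n k : nat) : word :=
  shift k (triangle_in (n - k) ++ triangle_out (n - k)).

Definition Dweb (n k : nat) : comb := clasps n * web (stem n k) * clasps n.

Definition ups (n : nat) : seq bool := nseq n true.

Lemma is_web_Hword N i : (i.+1 < N)%N -> is_web (ups N) (ups N) (Hword i).
Proof.
move=> hi; have -> : ups N = ups i ++ [:: true; true] ++ ups (N - i.+2).
  by rewrite -[[:: true; true]]/(nseq 2 true) /ups -!nseqD addnA addn2 subnKC.
have := @is_web_shift (ups i) (ups (N - i.+2)) [:: true; true] [:: true; true]
  (Hword 0) isT.
by rewrite size_nseq /shift /= addn0.
Qed.

Lemma web_comb_crossing N pos i :
  (i.+1 < N)%N -> web_comb (ups N) (ups N) (crossing pos i).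
Proof.
move=> hi; rewrite /crossing.
by case: pos; apply: web_combB; apply: web_combZ; first [exact: web_comb1 |
  exact: (web_comb_web (is_web_Hword hi))].
Qed.

Lemma web_comb_clasp N i n :
  (i + n <= N)%N -> web_comb (ups N) (ups N) (clasp i n).
Proof.
elim: n => [|[|n] IHn] hi; [exact: web_comb1 | exact: web_comb1 |].
have hc : web_comb (ups N) (ups N) (clasp i n.+1).
  by apply: IHn; rewrite (leq_trans _ hi) // leq_add2l.
rewrite -[clasp i n.+2]/(clasp i n.+1 - (qint n.+1 / qint n.+2) *:
  (clasp i n.+1 * web (Hword (i + n)) * clasp i n.+1)).
apply: web_combB => //; apply/web_combZ/(web_combM _ hc)/(web_combM hc).
by apply/web_comb_web/is_web_Hword; rewrite -!addnS.
Qed.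

Lemma web_comb_prod (I : Type) (r : seq I) (F : I -> comb) a :
  (forall i, web_comb a a (F i)) -> web_comb a a (\prod_(i <- r) F i).
Proof.
move=> hF; elim: r => [|i r IHr]; first by rewrite big_nil; apply: web_comb1.
by rewrite big_cons; apply: web_combM (hF i) IHr.
Qed.

Lemma web_comb_clasps n : web_comb (ups (n + n)) (ups (n + n)) (clasps n).
Proof. by apply: web_combM; apply: web_comb_clasp; rewrite ?leq_addr. Qed.

Lemma web_comb_twist n m : web_comb (ups (n + n)) (ups (n + n)) (twist n m).
Proof.
apply: web_combM (web_comb_clasps n); apply: web_combM (web_comb_clasps n) _.
elim: `|m|%N => [|r IHr]; first exact: web_comb1.
rewrite exprS; apply: web_combM IHr.
apply: web_comb_prod => i; apply: web_comb_prod => j; apply: web_comb_crossing.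
have := ltn_ord i; have := ltn_ord j; move: (val i) (val j) => /= {}i {}j hj hi.
rewrite -addSn -subSn // subSS -addnS.
by rewrite leq_add // leq_subr.
Qed.

Lemma is_web_splits_at x j y :
  is_web (x ++ nseq j false ++ y) (x ++ ups j.*2 ++ y)
    [seq (size x + i.*2, Split false)%N | i <- iota 0 j].
Proof.
elim: j x => [|j IHj] x; first by rewrite /is_web /run /=.
rewrite /= addn0 /is_web run_cons.
rewrite (@step_piece x (Split false) (nseq j false ++ y)) //=.
have := IHj (x ++ [:: true; true]); rewrite -!catA /= => /eqP <-; apply/eqP.
congr run; rewrite -[1%N]/(1 + 0)%N iotaDl -map_comp; apply: eq_map => i /=.
by rewrite size_cat /= doubleS !addnS addn0 !addSn.
Qed.

Lemma is_web_merges_at x j y :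
  is_web (x ++ ups j.*2 ++ y) (x ++ nseq j false ++ y)
    [seq (size x + i, Merge true)%N | i <- iota 0 j].
Proof.
elim: j x => [|j IHj] x; first by rewrite /is_web /run /=.
rewrite /= addn0 /is_web run_cons.
rewrite (@step_piece x (Merge true) (ups j.*2 ++ y)) //=.
have := IHj (x ++ [:: false]); rewrite -!catA /= => /eqP <-; apply/eqP.
congr run; rewrite -[1%N]/(1 + 0)%N iotaDl -map_comp; apply: eq_map => i /=.
by rewrite size_cat /= addn1 addSn addnS.
Qed.

Lemma ups_rcons k : ups k ++ [:: true] = ups k.+1.
Proof. by rewrite -[[:: true]]/(nseq 1 true) -nseqD addn1. Qed.

Lemma is_web_triangle_in j :
  is_web (ups (j + j)) (nseq j false) (triangle_in j).
Proof.
elim: j => [|j IHj]; first by rewrite /is_web /run /=.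
have -> : ups (j.+1 + j.+1) = [:: true] ++ ups (j + j) ++ [:: true].
  by rewrite ups_rcons addnS.
apply: is_web_cat (@is_web_shift [:: true] [:: true] _ _ _ IHj) _.
apply: is_web_cat (@is_web_splits_at [:: true] j [:: true]) _.
have := @is_web_merges_at [::] j.+1 [::].
by rewrite !cats0 /= ups_rcons.
Qed.

Lemma is_web_triangle_out j :
  is_web (nseq j false) (ups (j + j)) (triangle_out j).
Proof.
elim: j => [|j IHj]; first by rewrite /is_web /run /=.
have -> : ups (j.+1 + j.+1) = [:: true] ++ ups (j + j) ++ [:: true].
  by rewrite ups_rcons addnS.
have hs := @is_web_splits_at [::] j.+1 [::].
rewrite !cats0 /= in hs; apply: is_web_cat hs _.
apply: is_web_cat (@is_web_shift [:: true] [:: true] _ _ _ IHj).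
have := @is_web_merges_at [:: true] j [:: true].
by rewrite /= ups_rcons.
Qed.

Lemma is_web_stem n k :
  (k <= n)%N -> is_web (ups (n + n)) (ups (n + n)) (stem n k).
Proof.
move=> hk; set j := (n - k)%N.
have -> : ups (n + n) = ups k ++ ups (j + j) ++ ups k.
  by rewrite -!nseqD -addnA (subnK hk) addnA (subnKC hk).
have := @is_web_shift (ups k) (ups k) _ _ _
  (is_web_cat (is_web_triangle_in j) (is_web_triangle_out j)).
by rewrite size_nseq.
Qed.

Lemma web_comb_Dweb n k :
  (k <= n)%N -> web_comb (ups (n + n)) (ups (n + n)) (Dweb n k).
Proof.
move=> /is_web_stem/web_comb_web hs.
exact: web_combM (web_combM (web_comb_clasps n) hs) (web_comb_clasps n).
Qed.

Definition ribbon_space (n : nat) := web_space (ups (n + n)) (ups (n + n)).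
HB.instance Definition _ n := GRing.Lmodule.on (ribbon_space n).

Definition ribbon_class (n : nat) (f : comb) : ribbon_space n :=
  web_class (ups (n + n)) (ups (n + n)) f.

(* ks is the list k_1, ..., k_r, and k_0 = n. *)
Definition chi_pos (n : nat) (ks : seq nat) : K :=
  let m := size ks in
  let k i := nth 0%N (n :: ks) i in
  (-1) ^+ (n * m) *
  (q6 (- ((n%:Z ^+ 2 + 3 * n%:Z) * m%:Z)) * q6 (3 * (n%:Z - (k m)%:Z)) *
   (-1) ^+ (\sum_(1 <= i < m.+1) k i)%N *
   q6 (\sum_(1 <= i < m.+1) 3 * ((k i)%:Z ^+ 2 + (k i)%:Z)) * qpoch n) /
  ((\prod_(1 <= i < m.+1) qpoch (k i.-1 - k i)) * qpoch (k m)).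

Definition chi_neg (n : nat) (ks : seq nat) : K :=
  let r := size ks in
  let k i := nth 0%N (n :: ks) i in
  (-1) ^+ (n * r) *
  (q6 ((n%:Z ^+ 2 + 3 * n%:Z) * r%:Z) * q6 (- (3 * (n%:Z - (k r)%:Z))) *
   (-1) ^+ (\sum_(1 <= i < r.+1) k i)%N *
   q6 (\sum_(1 <= i < r.+1) 3 * ((k i)%:Z ^+ 2 - (k i)%:Z)) *
   q6 (- (\sum_(1 <= i < r.+1) 6 * ((k i.-1)%:Z * (k i)%:Z))) * qpoch n) /
  ((\prod_(1 <= i < r.+1) qpoch (k i.-1 - k i)) * qpoch (k r)).

(* The list k_1, ..., k_r; the chain k_r <= ... <= k_1 <= n is path geq n. *)
Definition kseq (n r : nat) (k : r.-tuple 'I_n.+1) : seq nat :=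
  [seq nat_of_ord i | i <- k].

(* Main.v *)
From HB Require Import structures.
From mathcomp Require Import all_boot all_order all_algebra.
From mathcomp Require Import zify ring.
From mathcomp.multinomials Require Import monalg.
Require Import Defs.

(** The webs H_i on the strands i and i+1 generate all that occurs in the
    theorem. They act from the right on the web space with 2n upward strands
    at both ends, and the proof only uses this action. A crossing is a
    scalar times H_i - t, with t = q^(1/2), or t = q^(-1/2) for a negative
    crossing, and a triangle glued to its mirror image is a product of
    H_i's, arranged in a diamond (weq_stem). The relations are H_i H_i = (t
    + 1/t) H_i, the commutation of distant H_i, and H_i H_(i+1) H_i - H_i =
    H_(i+1) H_i H_(i+1) - H_(i+1): by the square relation both sides are the
    web in which three strands end in a sink, below a source (hact_braid).

    Let x be the identity of the 2n strands closed by the two clasps. By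
    Wenzl's recursion x is killed by all H_i but the middle one
    (wenzl_kill). For each word in n letters L and n letters R let x_w be x
    followed by the braid without superfluous crossings, all of the given
    sign, that carries the word L^n R^n to w. The braid relations alone show
    that H_i kills x_w if the letters i and i+1 of w agree, and that, up to
    a scalar, a crossing turns LR into RL (e_shuffle_same, cross_shuffle).
    Hence H_i sends LR to the cup t LR + RL and RL to t^-1 times this cup:
    on the vectors x_w the H_i act as the Temperley-Lieb algebra does on
    words in two letters (tl_wordvec), and everything becomes explicit. The
    half twist carries L^n R^n to R^n L^n up to a scalar, and a diamond of
    size j turns L^j R^j into j nested cups and R^j L^j into t^-j times j
    nested cups (eact_diamond).

    The clasps on top kill every cup inside a ribbon, so there RL may be
    replaced with - t LR. Let X be one half twist and b the scalar of a
    crossing. Then X D_k is b^(n^2) t^-(n-k) times the clasped vector R^k (n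
    - k nested cups) L^k, while D_l is L^l (n - l nested cups) R^l.
    Expanding the outermost cup relates these vectors by a Pascal rule
    (mixedS), whence X D_k = b^(n^2) sum_l (-1)^l t^(l^2+k-n) [k choose
    l]_(t^2) D_l (clasped_diamond_twist). The half twist maps x to a vector
    that is killed in the same way, so this can be iterated, and the
    coefficients for m half twists are sums over chains n >= k_1 >= ... >=
    k_m of products of these entries (clasped_diamond_twists). The
    q-factorials telescope along a chain, which gives chi (chain_pos,
    chain_neg). *)

Set Implicit Arguments.
Unset Strict Implicit.
Unset Printing Implicit Defensive.

Import GRing.Theory.
Local Open Scope ring_scope.

(** * q-binomial coefficients *)

Section QBinomial.
Variables (F : fieldType) (z : F).

Fixpoint qbin (n k : nat) : F :=
  match n, k with
  | _, 0%N => 1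
  | 0%N, _.+1 => 0
  | n'.+1, k'.+1 => qbin n' k + z ^+ (n' - k') * qbin n' k'
  end.

Lemma qbin0 n : qbin n 0 = 1. Proof. by case: n. Qed.

Lemma qbinS n k : qbin n.+1 k.+1 = qbin n k.+1 + z ^+ (n - k) * qbin n k.
Proof. by []. Qed.

Lemma qbin_small n k : (n < k)%N -> qbin n k = 0.
Proof.
elim: n k => [|n IHn] [|k] // hk.
by rewrite qbinS !IHn ?mulr0 ?addr0 //; lia.
Qed.

Definition poch k : F := \prod_(1 <= i < k.+1) (1 - z ^+ i).

Lemma pochS k : poch k.+1 = poch k * (1 - z ^+ k.+1).
Proof. by rewrite /poch big_nat_recr. Qed.

Lemma poch0 : poch 0 = 1. Proof. by rewrite /poch big_geq. Qed.

Lemma qbin_poch n k : (k <= n)%N -> qbin n k * (poch (n - k) * poch k) = poch n.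
Proof.
elim: n k => [|n IHn] [|k] // hk; first by rewrite qbin0 poch0 !mulr1.
  by rewrite qbin0 subn0 poch0 mulr1 mul1r.
rewrite qbinS subSS mulrDl; have [hkn|hkn] := ltnP k n.
  have -> : (n - k = (n - k.+1).+1)%N by lia.
  have h1 := IHn k.+1 hkn; have := IHn k hk.
  have -> : (n - k = (n - k.+1).+1)%N by lia.
  move=> h2; rewrite !pochS.
  transitivity (qbin n k.+1 * (poch (n - k.+1) * poch k.+1) * (1 - z ^+ (n - k.+1).+1)
    + z ^+ (n - k.+1).+1 * (qbin n k * (poch (n - k.+1).+1 * poch k)) * (1 - z ^+ k.+1)).
    by rewrite !pochS; ring.
  rewrite h1 h2; have -> : z ^+ n.+1 = z ^+ (n - k.+1).+1 * z ^+ k.+1.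
    by rewrite -exprD; congr (_ ^+ _); lia.
  by ring.
rewrite qbin_small // mul0r add0r; have -> : k = n by lia.
have h : qbin n n * poch n = poch n.
  by have := IHn n (leqnn n); rewrite subnn poch0 mul1r.
by rewrite subnn expr0 poch0 !mul1r pochS mulrA h.
Qed.

End QBinomial.

Lemma big_tuple_cons (V : nmodType) (T : finType) m (P : pred (m.+1.-tuple T))
    (f : m.+1.-tuple T -> V) :
  \sum_(s | P s) f s =
  \sum_(a : T) \sum_(s : m.-tuple T | P (cons_tuple a s)) f (cons_tuple a s).
Proof.
rewrite pair_big_dep (reindex (fun p : T * m.-tuple T => cons_tuple p.1 p.2)) //=.
exists (fun s => (thead s, behead_tuple s)) => [[a s] _ | s _] /=.
  by congr pair; apply/val_inj.
by rewrite [s in RHS]tuple_eta.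
Qed.

(** * Diamonds of H's *)

(** The heights of r factors H side by side, the first on the strands p and
    p+1. *)
Definition Hrow p r := [seq (p + i.*2)%N | i <- iota 0 r].

Lemma HrowS p r : Hrow p r.+1 = p :: Hrow p.+2 r.
Proof.
rewrite /Hrow /= addn0 -[1%N]/(1 + 0)%N iotaDl -map_comp; congr cons.
by apply: eq_map => i /=; lia.
Qed.

Lemma Hrow_rcons p r : Hrow p r.+1 = Hrow p r ++ [:: (p + r.*2)%N].
Proof. by rewrite /Hrow -addn1 iotaD map_cat. Qed.

(** The rows of H's below and above the longest row of the diamond of size
    j, which occupies the strands p, ..., p + 2j - 1. *)
Fixpoint lower p j := if j is j'.+1 then lower p.+1 j' ++ Hrow p.+1 j' else [::].
Fixpoint upper p j := if j is j'.+1 then Hrow p.+1 j' ++ upper p.+1 j' else [::].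
Definition diamond p j := lower p j ++ Hrow p j ++ upper p j.

(** * The half twist in terms of the Hecke relations *)

(** The operators e i stand for the right action of H_i, so composition of
    operators is read in the order of the strands from the bottom upwards. *)
Section HeckeAction.
Variables (F : fieldType) (V : lmodType F) (N : nat) (t : F).
Variable e : nat -> {linear V -> V}.
Hypothesis t_neq0 : t != 0.
Hypothesis e_sqr : forall i v, (i.+1 < N)%N -> e i (e i v) = (t + t^-1) *: e i v.
Hypothesis e_hexagon : forall i v, (i.+2 < N)%N ->
  e i (e i.+1 (e i v)) - e i v = e i.+1 (e i (e i.+1 v)) - e i.+1 v.
Hypothesis e_comm : forall i j v, (i.+1 < j)%N -> (j.+1 < N)%N ->
  e i (e j v) = e j (e i v).

(** A crossing of the strands i and i+1, up to a scalar. The normalisation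
    is the one for which a crossing turns the basis vector of a word LR into
    that of RL. *)
Definition cross (i : nat) : {linear V -> V} := e i \- t \*: idfun.

Lemma crossE i v : cross i v = e i v - t *: v. Proof. by []. Qed.

Local Opaque cross.

Definition far i j := ((i.+1 < j) || (j.+1 < i))%N.

Lemma far_eC i j v : far i j -> (i.+1 < N)%N -> (j.+1 < N)%N ->
  e i (e j v) = e j (e i v).
Proof.
case/orP=> h hi hj; first exact: e_comm.
by symmetry; apply: e_comm.
Qed.

Lemma e_cross_far i j v : far i j -> (i.+1 < N)%N -> (j.+1 < N)%N ->
  e i (cross j v) = cross j (e i v).
Proof. by move=> h hi hj; rewrite !crossE linearB linearZ /= (far_eC _ h). Qed.

Lemma e_cross i v : (i.+1 < N)%N -> e i (cross i v) = t^-1 *: e i v.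
Proof.
move=> hi; rewrite crossE linearB linearZ /= e_sqr // scalerDl.
by rewrite addrC addKr.
Qed.

Lemma cross_e i v : (i.+1 < N)%N -> cross i (e i v) = t^-1 *: e i v.
Proof. by move=> hi; rewrite crossE e_sqr // scalerDl addrC addKr. Qed.

(** Third Reidemeister move with an H in place of one crossing: an H slides
    through a strand that crosses both of its legs. *)
Lemma e_cross_braid i v : (i.+2 < N)%N ->
  e i (cross i.+1 (cross i v)) = cross i.+1 (cross i (e i.+1 v)).
Proof.
move=> hi; have hi' : (i.+1 < N)%N by lia.
have /eqP := e_hexagon v hi; rewrite subr_eq => /eqP eBi.
transitivity (e i (e i.+1 (e i v)) - t *: e i (e i.+1 v) - e i v).
  rewrite [cross i.+1 _]crossE linearB linearZ /= e_cross // scalerA mulfV // scale1r.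
  by rewrite crossE !linearB !linearZ.
transitivity (e i.+1 (e i (e i.+1 v)) - t *: e i (e i.+1 v) - e i.+1 v).
  by rewrite eBi addrAC addrK addrAC.
symmetry; rewrite [cross i _]crossE linearB linearZ /= cross_e //.
rewrite scalerA mulfV // scale1r.
by rewrite crossE.
Qed.

Lemma e_cross_braid' i v : (i.+2 < N)%N ->
  e i.+1 (cross i (cross i.+1 v)) = cross i (cross i.+1 (e i v)).
Proof.
move=> hi; have hi' : (i.+1 < N)%N by lia.
have /eqP := e_hexagon v hi; rewrite eq_sym subr_eq => /eqP eBi.
transitivity (e i.+1 (e i (e i.+1 v)) - t *: e i.+1 (e i v) - e i.+1 v).
  rewrite [cross i _]crossE linearB linearZ /= e_cross // scalerA mulfV // scale1r.
  by rewrite crossE !linearB !linearZ.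
transitivity (e i (e i.+1 (e i v)) - t *: e i.+1 (e i v) - e i v).
  by rewrite eBi addrAC addrK addrAC.
symmetry; rewrite [cross i.+1 _]crossE linearB linearZ /= cross_e //.
rewrite scalerA mulfV // scale1r.
by rewrite crossE.
Qed.

(** The strand p crosses the q strands to its right, one after the other. *)
Fixpoint sweep p q : {linear V -> V} :=
  if q is q'.+1 then (cross (p + q') \o sweep p q' : {linear V -> V}) else idfun.

Lemma sweepS p q v : sweep p q.+1 v = cross (p + q) (sweep p q v).
Proof. by []. Qed.

Lemma e_sweep_far i p q v : (i.+1 < p \/ p + q < i)%N ->
  (i.+1 < N)%N -> (p + q < N)%N ->
  e i (sweep p q v) = sweep p q (e i v).
Proof.
move=> h hi; elim: q h => [|q IHq] // h hq.
by rewrite !sweepS e_cross_far ?IHq //; rewrite /far; lia.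
Qed.

Lemma cross_sweep_far i p q v : (i.+1 < p \/ p + q < i)%N ->
  (i.+1 < N)%N -> (p + q < N)%N ->
  cross i (sweep p q v) = sweep p q (cross i v).
Proof. by move=> h hi hq; rewrite !crossE e_sweep_far // -linearZ -linearB. Qed.

Lemma e_sweep i p q v : (p <= i)%N -> (i.+1 < p + q)%N -> (p + q < N)%N ->
  e i (sweep p q v) = sweep p q (e i.+1 v).
Proof.
move=> hp; elim: q => [|q IHq] hi hq; first by lia.
rewrite !sweepS; have [hiq|hiq] := ltnP i.+1 (p + q).
  by rewrite e_cross_far ?IHq // /far; lia.
have -> : (p + q = i.+1)%N by lia.
case: q {IHq} hi hq hiq => [|q] hi hq hiq; first by lia.
have Ei : (p + q = i)%N by lia.
by rewrite !sweepS Ei e_cross_braid ?e_sweep_far //; lia.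
Qed.

(** Two neighbouring strands that cross the same q strands carry an H
    between them along. *)
Lemma e_sweep2 p q v : (p + q.+1 < N)%N ->
  e (p + q) (sweep p q (sweep p.+1 q v)) = sweep p q (sweep p.+1 q (e p v)).
Proof.
elim: q v => [|q IHq] v hq; first by rewrite addn0.
rewrite !sweepS -!cross_sweep_far ?addSn -?addnS; try lia.
rewrite !addnS e_cross_braid' ?IHq //; lia.
Qed.

Local Notation nl := (count id).
Local Notation nr := (count negb).

(** The braid that carries the word L^p R^q to a given word with p letters L
    = true and q letters R = false, without crossing two strands of the same
    ribbon. The word is read from its last letter: a last letter L means
    that the rightmost strand of the left ribbon first sweeps over the whole
    right ribbon, after which it can be forgotten; a last letter R can be
    forgotten at once. *)
Fixpoint shuffle (r : seq bool) : {linear V -> V} :=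
  if r is c :: r' then
    if c then (shuffle r' \o sweep (nl r') (nr r') : {linear V -> V}) else shuffle r'
  else idfun.

Lemma size_nlr r : (nl r + nr r = size r)%N.
Proof. exact: count_predC. Qed.

Lemma e_shuffle_far i r v : (size r <= i)%N -> (i.+1 < N)%N ->
  e i (shuffle r v) = shuffle r (e i v).
Proof.
elim: r v => [|[] r IHr] v //= hr hi; last by apply: IHr; lia.
by have hs := size_nlr r; rewrite IHr ?e_sweep_far //; lia.
Qed.

(** The property of a vector closed by clasps on the first p and on the next
    q strands; the position p - 1 is the one where the two ribbons meet. *)
Definition killed p q (x : V) :=
  forall i, (i.+1 < p + q)%N -> i.+1 != p -> e i x = 0.

(** After the sweep the strand that has moved is the last one, and each
    remaining e i slides back through the sweep to a position in one of the
    two clasps. *)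
Lemma killed_sweep p q x : (p.+1 + q <= N)%N ->
  killed p.+1 q x -> killed p q (sweep p q x).
Proof.
move=> hN hx i hi hp; have [hip|hip] := ltnP i.+1 p.
  by rewrite e_sweep_far ?hx ?linear0 //; lia.
by rewrite e_sweep ?hx ?linear0 //; lia.
Qed.

Lemma killedW p q x : killed p q.+1 x -> killed p q x.
Proof. by move=> hx i hi; apply: hx; lia. Qed.

(** Two equal neighbouring letters come from neighbouring strands of one
    ribbon, which cross the same strands: the H between them slides down to
    the clasp. *)
Lemma e_shuffle_same c r1 r2 x (r := r1 ++ c :: c :: r2) :
  (size r <= N)%N -> killed (nl r) (nr r) x -> e (size r2) (shuffle r x) = 0.
Proof.
rewrite {}/r; elim: r1 x => [|[] r1 IHr] x /=.
- have hs := size_nlr r2; case: c => /= hN hx; rewrite !add0n in hx *.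
    rewrite e_shuffle_far //; try lia.
    rewrite -hs e_sweep2; try lia.
    by rewrite hx ?linear0 //; lia.
  by rewrite e_shuffle_far ?hx ?linear0 //; lia.
- move=> hN hx; apply: IHr; first lia.
  by apply: killed_sweep => //; rewrite addSn size_nlr; lia.
- move=> hN hx; apply: IHr; first lia.
  by apply: killedW; rewrite add0n in hx.
Qed.

Lemma cross_shuffle r1 r2 x (r := r1 ++ false :: true :: r2) :
  (size r <= N)%N -> killed (nl r) (nr r) x ->
  cross (size r2) (shuffle r x) = shuffle (r1 ++ true :: false :: r2) x.
Proof.
rewrite {}/r; elim: r1 x => [|[] r1 IHr] x /=.
- have hs := size_nlr r2; move=> hN hx; rewrite ?add0n in hx *.
  rewrite [LHS]crossE e_shuffle_far //; try lia.
  by rewrite -linearZ -linearB -crossE -hs.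
- have -> : nl (r1 ++ true :: false :: r2) = nl (r1 ++ false :: true :: r2).
    by rewrite !count_cat /=; lia.
  have -> : nr (r1 ++ true :: false :: r2) = nr (r1 ++ false :: true :: r2).
    by rewrite !count_cat /=; lia.
  move=> hN hx; apply: IHr; first lia.
  by apply: killed_sweep => //; rewrite addSn size_nlr; lia.
- move=> hN hx; apply: IHr; first lia.
  by apply: killedW; rewrite add0n in hx.
Qed.

Variables (n : nat) (nN : (n + n <= N)%N).

Definition balanced w := (nl w == n) && (nr w == n).

Definition half_twist_op : {linear V -> V} := shuffle (nseq n true ++ nseq n false).

Section Vector.
Variable x : V.
Hypothesis kx : killed n n x.

(** Words with the wrong number of letters are sent to 0, so that the
    identities below hold for all words and linear combinations of words
    need no side condition. *)
Definition wordvec w : V := if balanced w then shuffle (rev w) x else 0.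

(** The action of H on two neighbouring tensor factors of the quantum plane:
    equal letters are killed, and the other two words go to multiples of the
    cup t LR + RL. The predicate is about a family of vectors, rather than
    words, because it passes to linear combinations (tl_lin). *)
Definition tl i (G : bool -> bool -> V) :=
  [/\ forall c, e i (G c c) = 0,
      e i (G true false) = t *: G true false + G false true &
      e i (G false true) = t^-1 *: (t *: G true false + G false true)].

Lemma balanced_size w : balanced w -> (size w = n + n)%N.
Proof. by rewrite -(size_nlr w) => /andP[/eqP-> /eqP->]. Qed.

(** This is where the Temperley-Lieb relations come from: they fail for the
    H_i as operators, but they hold on the vectors generated from one that
    is killed within both ribbons. *)
Lemma tl_wordvec u v : tl (size u) (fun a b => wordvec (u ++ a :: b :: v)).
Proof.
have sz a b : balanced (u ++ a :: b :: v) -> ((size u).+2 + size v = n + n)%N.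
  by move/balanced_size; rewrite size_cat /= !addnS.
have revE a b : rev (u ++ a :: b :: v) = rev v ++ b :: a :: rev u.
  by rewrite rev_cat !rev_cons -!cats1 -!catA.
have killedw a b : balanced (u ++ a :: b :: v) ->
    killed (nl (rev v ++ b :: a :: rev u)) (nr (rev v ++ b :: a :: rev u)) x.
  by rewrite -revE !count_rev => /andP[/eqP-> /eqP->].
have swp : balanced (u ++ false :: true :: v) = balanced (u ++ true :: false :: v).
  by rewrite /balanced !count_cat.
rewrite /wordvec; split=> [c||].
- case: ifP => hb; last by rewrite linear0.
  rewrite revE -(size_rev u) (e_shuffle_same _ (killedw _ _ hb)) //.
  by rewrite size_cat /= !size_rev; have := sz _ _ hb; lia.
- rewrite /= swp; case: ifP => hb; last by rewrite linear0 scaler0 addr0.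
  rewrite !revE -(cross_shuffle _ (killedw _ _ hb)) //; last first.
    by rewrite size_cat /= !size_rev; have := sz _ _ hb; lia.
  by rewrite size_rev crossE addrC subrK.
- rewrite /= swp; case: ifP => hb; last by rewrite linear0 scaler0 addr0 scaler0.
  have hi : ((size u).+1 < N)%N by have := sz _ _ hb; lia.
  rewrite !revE -(cross_shuffle _ (killedw _ _ hb)) //; last first.
    by rewrite size_cat /= !size_rev; have := sz _ _ hb; lia.
  by rewrite size_rev e_cross // crossE [t *: _ + _]addrC subrK.
Qed.

Lemma tl_ext i G H : (forall a b, G a b = H a b) -> tl i G -> tl i H.
Proof. by move=> eGH [h1 h2 h3]; split=> [c||]; rewrite -!eGH. Qed.

Lemma tl_lin i c G H : tl i G -> tl i H -> tl i (fun a b => c *: G a b + H a b).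
Proof.
case=> g1 g2 g3 [h1 h2 h3]; split=> [a||]; rewrite linearD linearZ /=.
- by rewrite g1 h1 scaler0 addr0.
- by rewrite g2 h2 !scalerDr !scalerA [t * c]mulrC addrACA.
- rewrite g3 h3 scalerA mulrC -scalerA -scalerDr; congr (_ *: _).
  by rewrite !scalerDr !scalerA [t * c]mulrC addrACA.
Qed.

(** A strand next to a cup, hit by an H, is straightened: it comes out on
    the other side of the cup. *)
Lemma e_zigzag i (G : bool -> bool -> bool -> V) a :
  (forall c, tl i (fun a b => G a b c)) ->
  e i (t *: G a true false + G a false true) = t *: G true false a + G false true a.
Proof.
move=> hG; have [f1 f2 f3] := hG false; have [g1 g2 g3] := hG true.
rewrite linearD linearZ /=; case: a.
  by rewrite f1 g2 scaler0 add0r.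
by rewrite f3 g1 addr0 scalerA mulfV // scale1r.
Qed.

(** The word u, then r cups side by side, then the word v. The sum is over
    the two letterings of each cup. *)
Fixpoint cups r u v : V :=
  if r is r'.+1 then
    t *: cups r' (u ++ [:: true; false]) v + cups r' (u ++ [:: false; true]) v
  else wordvec (u ++ v).

Lemma tl_cups r u w v : tl (size u) (fun a b => cups r (u ++ a :: b :: w) v).
Proof.
elim: r w => [|r IHr] w /=.
  by apply: tl_ext (tl_wordvec u (w ++ v)) => a b; rewrite -catA.
by apply: tl_ext (tl_lin t (IHr (w ++ [:: true; false]))
  (IHr (w ++ [:: false; true]))) => a b; rewrite -!catA.
Qed.

Lemma tl_cups_right r u w v :
  tl (size u + r.*2 + size w) (fun a b => cups r u (w ++ a :: b :: v)).
Proof.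
elim: r u => [|r IHr] u /=.
  rewrite addn0 -size_cat.
  by apply: tl_ext (tl_wordvec (u ++ w) v) => a b; rewrite catA.
have h b c : tl (size u + r.*2.+2 + size w)
    (fun a b' => cups r (u ++ [:: b; c]) (w ++ a :: b' :: v)).
  by have := IHr (u ++ [:: b; c]); rewrite size_cat /= addn2 !addSn !addnS.
exact: tl_lin.
Qed.

Lemma cups_rcons r u v :
  cups r.+1 u v = t *: cups r u (true :: false :: v) + cups r u (false :: true :: v).
Proof.
elim: r u => [|r IHr] u; first by rewrite /= -!catA.
rewrite [LHS]/= -/(cups r.+1 _ _) -/(cups r.+1 _ _) !IHr /=.
by rewrite !scalerDr !scalerA addrACA.
Qed.

Definition eact (s : seq nat) v := foldl (fun v i => e i v) v s.

Lemma eact_cat s1 s2 v : eact (s1 ++ s2) v = eact s2 (eact s1 v).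
Proof. exact: foldl_cat. Qed.

Lemma eactD s u v : eact s (u + v) = eact s u + eact s v.
Proof. by elim: s u v => //= i s IHs u v; rewrite linearD IHs. Qed.

Lemma eactZ s c v : eact s (c *: v) = c *: eact s v.
Proof. by elim: s v => //= i s IHs v; rewrite linearZ IHs. Qed.

(** A row of H's moves a single strand from the left to the right of a row
    of cups, one cup at a time. *)
Lemma eact_zig r u a v :
  eact (Hrow (size u) r) (cups r (u ++ [:: a]) v) = cups r u (a :: v).
Proof.
elim: r u => [|r IHr] u; first by rewrite /= -catA.
rewrite HrowS /= -!catA /=.
rewrite (e_zigzag (G := fun b c d => cups r (u ++ [:: b; c; d]) v)); last first.
  by move=> c; apply: tl_cups.
rewrite eactD eactZ.
have h b c : eact (Hrow (size u).+2 r) (cups r (u ++ [:: b; c; a]) v) =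
    cups r (u ++ [:: b; c]) (a :: v).
  have -> : u ++ [:: b; c; a] = (u ++ [:: b; c]) ++ [:: a] by rewrite -catA.
  by rewrite -IHr size_cat addn2.
by rewrite !h.
Qed.

(** The coefficient with which the letters a and ~~ a make a cup under H. *)
Definition cup_weight a : F := if a then 1 else t^-1.

(** The strand a is moved next to its partner ~~ a, and the last H joins
    them to one more cup. *)
Lemma cups_up r u a v :
  eact (Hrow (size u) r.+1) (cups r (u ++ [:: a]) (~~ a :: v)) =
  cup_weight a *: cups r.+1 u v.
Proof.
have [_ h2 h3] := tl_cups_right r u [::] v.
rewrite Hrow_rcons eact_cat eact_zig cups_rcons.
by rewrite addn0 in h2 h3; case: a => /=; rewrite ?h2 ?h3 ?scale1r.
Qed.

(** The leftmost cup is opened; its right end moves through all other cups,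
    so it now surrounds them. *)
Lemma cups_down r u v :
  eact (Hrow (size u).+1 r) (cups r.+1 u v) =
  t *: cups r (u ++ [:: true]) (false :: v) + cups r (u ++ [:: false]) (true :: v).
Proof.
rewrite /= eactD eactZ; congr (t *: _ + _).
  have -> : u ++ [:: true; false] = (u ++ [:: true]) ++ [:: false] by rewrite -catA.
  by rewrite -eact_zig size_cat addn1.
have -> : u ++ [:: false; true] = (u ++ [:: false]) ++ [:: true] by rewrite -catA.
by rewrite -eact_zig size_cat addn1.
Qed.

(** The word u, then j nested cups, then the word v. *)
Fixpoint nest j u v : V :=
  if j is j'.+1 then
    t *: nest j' (u ++ [:: true]) (false :: v) + nest j' (u ++ [:: false]) (true :: v)
  else wordvec (u ++ v).

Lemma eact_lower j u a v :
  eact (lower (size u) j ++ Hrow (size u) j)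
    (wordvec (u ++ nseq j a ++ nseq j (~~ a) ++ v)) = cup_weight a ^+ j *: cups j u v.
Proof.
elim: j u v => [|j IHj] u v; first by rewrite scale1r.
have -> : u ++ nseq j.+1 a ++ nseq j.+1 (~~ a) ++ v =
    (u ++ [:: a]) ++ nseq j a ++ nseq j (~~ a) ++ (~~ a :: v).
  rewrite -!catA -[nseq j.+1 (~~ a)]/(nseq (1 + j) (~~ a)) addnC nseqD /=.
  by rewrite -!catA.
have := IHj (u ++ [:: a]) (~~ a :: v); rewrite size_cat addn1 => h.
by rewrite eact_cat [lower _ _]/= h eactZ cups_up scalerA exprSr.
Qed.

Lemma eact_upper j u v : eact (upper (size u) j) (cups j u v) = nest j u v.
Proof.
elim: j u v => [|j IHj] u v //.
rewrite [upper _ _]/= eact_cat cups_down eactD eactZ /= -!IHj.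
by rewrite !size_cat !addn1.
Qed.

(** The rows of growing length turn a^j (~~ a)^j into j cups side by side,
    the rows of decreasing length nest them. *)
Lemma eact_diamond j u a v :
  eact (diamond (size u) j) (wordvec (u ++ nseq j a ++ nseq j (~~ a) ++ v)) =
  cup_weight a ^+ j *: nest j u v.
Proof. by rewrite /diamond catA eact_cat eact_lower eactZ eact_upper. Qed.

Lemma tl_nest_left j u w v : tl (size u) (fun a b => nest j (u ++ a :: b :: w) v).
Proof.
elim: j w v => [|j IHj] w v /=.
  by apply: tl_ext (tl_wordvec u (w ++ v)) => a b; rewrite -catA.
by apply: tl_ext (tl_lin t (IHj (w ++ [:: true]) (false :: v))
  (IHj (w ++ [:: false]) (true :: v))) => a b; rewrite -!catA.
Qed.

Lemma tl_nest_right j u w v :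
  tl (size u + j.*2 + size w) (fun a b => nest j u (w ++ a :: b :: v)).
Proof.
elim: j u w => [|j IHj] u w /=.
  rewrite addn0 -size_cat.
  by apply: tl_ext (tl_wordvec (u ++ w) v) => a b; rewrite catA.
have h b c : tl (size u + j.*2.+2 + size w)
    (fun a b' => nest j (u ++ [:: b]) (c :: w ++ a :: b' :: v)).
  by have := IHj (u ++ [:: b]) (c :: w); rewrite size_cat /= addn1 !addSn !addnS.
exact: tl_lin.
Qed.

Variable Pr : {linear V -> V}.
Hypothesis PrE : forall i v, (i.+1 < n + n)%N -> i.+1 != n -> Pr (e i v) = 0.

(** The clasp kills the cup t LR + RL, that is, identifies RL with - t LR. *)
Lemma clasp_swap i G : tl i G -> (i.+1 < n + n)%N -> i.+1 != n ->
  Pr (G false true) = - t *: Pr (G true false).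
Proof.
case=> _ h _ hi hin; have := PrE (G true false) hi hin; rewrite h linearD linearZ /=.
by move=> /eqP; rewrite addrC addr_eq0 => /eqP ->; rewrite scaleNr.
Qed.

Lemma nseq_shift (T : Type) k (a : T) s : nseq k a ++ a :: s = nseq k.+1 a ++ s.
Proof. by elim: k => //= k ->. Qed.

Lemma clasp_left j l i w v : (l + i < n)%N ->
  Pr (nest j (nseq l true ++ nseq i false ++ true :: w) v) =
  (- t) ^+ i *: Pr (nest j (nseq l true ++ true :: nseq i false ++ w) v).
Proof.
elim: i w => [|i IHi] w hi; first by rewrite scale1r.
have -> : nseq i.+1 false ++ true :: w = nseq i false ++ false :: true :: w.
  by rewrite -[i.+1]addn1 nseqD -catA.
have h := tl_nest_left j (nseq l true ++ nseq i false) w v.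
rewrite size_cat !size_nseq in h.
have := clasp_swap h; rewrite -!catA => ->; try lia.
rewrite IHi; last lia.
by rewrite scalerA exprS -[i.+1 in RHS]addn1 nseqD -catA.
Qed.

Lemma clasp_right j i u z w : (size u + j = n)%N -> (j + size z + i < n)%N ->
  Pr (nest j u (z ++ false :: nseq i true ++ w)) =
  (- t) ^+ i *: Pr (nest j u (z ++ nseq i true ++ false :: w)).
Proof.
elim: i z => [|i IHi] z hu hi; first by rewrite scale1r.
rewrite (clasp_swap (tl_nest_right j u z (nseq i true ++ w))); try lia.
have -> : z ++ true :: false :: nseq i true ++ w =
  (z ++ [:: true]) ++ false :: nseq i true ++ w by rewrite -catA.
rewrite IHi ?size_cat //=; last lia.
by rewrite scalerA exprS -catA.
Qed.

(** The clasped words that interpolate between the nested cups in the middle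
    of R^i L^i (with l = 0), as they come out of a half twist, and those in
    the middle of L^l R^l (with i = 0), which are the webs D_l. *)
Definition mixed i l j : V :=
  Pr (nest j (nseq l true ++ nseq i false) (nseq i true ++ nseq l false)).

(** Expand the outermost of j + 1 nested cups. One lettering gives one more
    R on the left and one more L on the right; in the other one, L and R
    move past i letters each, which costs (- t) ^ i twice. *)
Lemma mixedS i l j : (i.+1 + l + j = n)%N ->
  mixed i.+1 l j = mixed i l j.+1 - t ^+ i.*2.+1 *: mixed i l.+1 j.
Proof.
move=> hn; rewrite {2}/mixed /= linearD linearZ /=.
have -> : (nseq l true ++ nseq i false) ++ [:: true] =
  nseq l true ++ nseq i false ++ true :: [::] by rewrite -catA.
rewrite clasp_left; last lia.
rewrite cats0 (@clasp_right _ _ _ [::]); first last.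
- by rewrite /=; lia.
- by rewrite size_cat /= !size_nseq; lia.
rewrite !scalerA.
have -> : t * ((- t) ^+ i * (- t) ^+ i) = t ^+ i.*2.+1.
  by rewrite -exprMn mulrNN exprS -expr2 -exprM mul2n.
have -> : nseq l true ++ true :: nseq i false = nseq l.+1 true ++ nseq i false.
  exact: nseq_shift.
have -> : [::] ++ nseq i true ++ false :: nseq l false = nseq i true ++ nseq l.+1 false.
  by [].
have -> : (nseq l true ++ nseq i false) ++ [:: false] = nseq l true ++ nseq i.+1 false.
  by rewrite -catA nseq_shift cats0.
by rewrite addrAC subrr add0r.
Qed.

(** The recurrence of mixedS is the Pascal rule for q-binomials at q = t ^
    2. *)
Definition mixed_coef i s : F := (-1) ^+ s * t ^+ (s ^ 2) * qbin (t ^+ 2) i s.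

Lemma mixed_coef0 i : mixed_coef i 0 = 1.
Proof. by rewrite /mixed_coef qbin0 !mulr1. Qed.

Lemma mixed_coefS i s : (s <= i)%N ->
  mixed_coef i.+1 s.+1 = mixed_coef i s.+1 - t ^+ i.*2.+1 * mixed_coef i s.
Proof.
move=> hs; rewrite /mixed_coef qbinS -exprM.
have -> : t ^+ i.*2.+1 * ((-1) ^+ s * t ^+ (s ^ 2) * qbin (t ^+ 2) i s) =
   (-1) ^+ s * (t ^+ i.*2.+1 * t ^+ (s ^ 2)) * qbin (t ^+ 2) i s by ring.
have -> : t ^+ i.*2.+1 * t ^+ (s ^ 2) = t ^+ (s.+1 ^ 2) * t ^+ (2 * (i - s)).
  by rewrite -!exprD; congr (_ ^+ _); rewrite !expnS !expn0 -[i in LHS](subnK hs); lia.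
by rewrite [(-1) ^+ s.+1]exprS; ring.
Qed.

Lemma mixed_expand i l j : (i + l + j = n)%N ->
  mixed i l j = \sum_(s < i.+1) mixed_coef i s *: mixed 0 (l + s) (j + i - s).
Proof.
elim: i l j => [|i IHi] l j hn.
  by rewrite big_ord1 mixed_coef0 scale1r !addn0 subn0.
rewrite mixedS // !IHi; try lia.
pose E s := mixed 0 (l + s) (j + i.+1 - s).
transitivity (\sum_(s < i.+2) mixed_coef i s *: E s -
    t ^+ i.*2.+1 *: \sum_(s < i.+1) mixed_coef i s *: E s.+1).
  congr (_ - _ *: _); last first.
    by apply: eq_bigr => s _; rewrite /E addnS addSn addnS subSS.
  rewrite [RHS]big_ord_recr /= [mixed_coef i i.+1]/mixed_coef qbin_small // mulr0 scale0r.
  by rewrite addr0; apply: eq_bigr => s _; rewrite /E addnS addSn.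
rewrite big_ord_recl [RHS]big_ord_recl /= !mixed_coef0 -addrA; congr (_ + _).
rewrite scaler_sumr -sumrB; apply: eq_bigr => s _.
by rewrite /= /bump /= !add1n mixed_coefS ?scalerBl ?scalerA // -ltnS.
Qed.

Lemma rev_nseq (T : Type) k (a : T) : rev (nseq k a) = nseq k a.
Proof. by elim: k => //= k IHk; rewrite rev_cons IHk -cats1 nseq_shift cats0. Qed.

Lemma balanced_halves a : balanced (nseq n a ++ nseq n (~~ a)).
Proof.
rewrite /balanced !count_cat !count_nseq.
by case: a; rewrite /= !mul1n !mul0n ?addn0 ?add0n !eqxx.
Qed.

Lemma wordvec_start : wordvec (nseq n true ++ nseq n false) = x.
Proof.
rewrite /wordvec (balanced_halves true) rev_cat !rev_nseq.
have -> k r : shuffle (nseq k false ++ r) = shuffle r by elim: k.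
by elim: n => //= k IHk; rewrite !count_nseq mul0n.
Qed.

Lemma wordvec_twist : wordvec (nseq n false ++ nseq n true) = half_twist_op x.
Proof. by rewrite /wordvec (balanced_halves false) rev_cat !rev_nseq. Qed.

(** The half twist exchanges the ribbons as blocks, so its result is again
    killed within both ribbons; this is what allows to iterate. *)
Lemma killed_twist : killed n n (half_twist_op x).
Proof.
move=> i hi hin; rewrite -wordvec_twist.
have [hlt|hge] := ltnP i.+1 n.
  have -> : nseq n false = nseq i false ++ false :: false :: nseq (n - i.+2) false.
    by rewrite -[_ :: _ :: _]/(nseq (2 + _) false) -nseqD; congr nseq; lia.
  have [h _ _] := tl_wordvec (nseq i false) (nseq (n - i.+2) false ++ nseq n true).
  by rewrite -catA; have := h false; rewrite size_nseq.
have {hge}hge : (n <= i)%N by lia.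
have -> : nseq n true = nseq (i - n) true ++ true :: true :: nseq (n + n - i.+2) true.
  by rewrite -[_ :: _ :: _]/(nseq (2 + _) true) -nseqD; congr nseq; lia.
have [h _ _] := tl_wordvec (nseq n false ++ nseq (i - n) true) (nseq (n + n - i.+2) true).
by rewrite catA; have := h true; rewrite size_cat !size_nseq subnKC.
Qed.

(** For y the clasped identity this is the web D_k. *)
Definition clasped_diamond k y := Pr (eact (diamond k (n - k)) y).

Lemma eact_diamond_halves k a : (k <= n)%N ->
  eact (diamond k (n - k)) (wordvec (nseq n a ++ nseq n (~~ a))) =
  cup_weight a ^+ (n - k) *: nest (n - k) (nseq k a) (nseq k (~~ a)).
Proof.
move=> hk; have := eact_diamond (n - k) (nseq k a) a (nseq k (~~ a)).
rewrite size_nseq !catA -nseqD -catA -nseqD subnKC // subnK //; exact.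
Qed.

(** The half twist turns L^n R^n into R^n L^n, whose middle part is made
    into nested cups by the diamond at the price of t^-1 for each of the n -
    k pairs; mixed_expand then brings the letters back to the order L before
    R. *)
Lemma clasped_diamond_twist k : (k <= n)%N ->
  clasped_diamond k (half_twist_op x) =
  \sum_(l < k.+1) (t^-1 ^+ (n - k) * mixed_coef k l) *: clasped_diamond l x.
Proof.
move=> hk; rewrite /clasped_diamond -wordvec_twist.
rewrite (eact_diamond_halves false hk) linearZ /=.
have := @mixed_expand k 0 (n - k); rewrite addn0 subnKC // => /(_ erefl).
rewrite {1}/mixed /= cats0 => ->; rewrite scaler_sumr; apply: eq_bigr => l _.
rewrite scalerA; congr (_ *: _); rewrite subnK // add0n.
(* the same diamond applied to L^n R^n, to recognize D_l on the right *)
rewrite /clasped_diamond -[in RHS]wordvec_start.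
rewrite (eact_diamond_halves true) ?expr1n ?scale1r; last first.
  by have := ltn_ord l; lia.
by rewrite /mixed /= cats0.
Qed.

End Vector.

Section Iterate.
Variable Pr : {linear V -> V}.
Hypothesis PrE : forall i v, (i.+1 < n + n)%N -> i.+1 != n -> Pr (e i v) = 0.

Lemma killed_iter m x : killed n n x -> killed n n (iter m half_twist_op x).
Proof. by move=> kx; elim: m => //= m; apply: killed_twist. Qed.

Fixpoint chain (c : nat -> nat -> F) k (ks : seq nat) : F :=
  if ks is l :: ks' then c k l * chain c l ks' else 1.

Definition twist_coef k l := t^-1 ^+ (n - k) * mixed_coef k l.

(** The theorem in terms of the Hecke action: the matrix of the half twist
    is triangular, and its power is a sum over decreasing chains. *)
Lemma clasped_diamond_twists m k x : killed n n x -> (k <= n)%N ->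
  clasped_diamond Pr k (iter m half_twist_op x) =
  \sum_(ks : m.-tuple 'I_n.+1 | path geq k [seq nat_of_ord i | i <- ks])
    chain twist_coef k [seq nat_of_ord i | i <- ks] *:
    clasped_diamond Pr (last k [seq nat_of_ord i | i <- ks]) x.
Proof.
move=> kx; elim: m k => [|m IHm] k hk.
  rewrite (big_pred1 [tuple]) ?scale1r // => ks.
  by rewrite tuple0 /=; symmetry; apply: eqxx.
rewrite iterS (clasped_diamond_twist (killed_iter m kx) PrE hk) big_tuple_cons.
rewrite (big_ord_widen n.+1 (fun l => (t^-1 ^+ (n - k) * mixed_coef k l) *:
  clasped_diamond Pr l (iter m half_twist_op x))) // big_mkcond; apply: eq_bigr => l _.
rewrite /= ltnS; case: leqP => hl /=; last by rewrite big_pred0.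
rewrite IHm; last by have := ltn_ord l.
rewrite scaler_sumr; apply: eq_bigr => ks _.
by rewrite scalerA.
Qed.
End Iterate.

Section Clasp.
Variable qn : nat -> F.
Hypothesis qn_neq0 : forall k, qn k.+1 != 0.
Hypothesis qn1 : qn 1 = 1.
Hypothesis qn2 : qn 2 = t + t^-1.
Hypothesis qnS : forall k, qn k.+2 = (t + t^-1) * qn k.+1 - qn k.

(** The right action of the clasp P_m on the strands i, ..., i + m - 1. *)
Fixpoint wenzl i m : {linear V -> V} :=
  if m is m'.+1 then
    if m' is m''.+1 then
      (wenzl i m' \-
       (qn m' / qn m) \*: (wenzl i m' \o (e (i + m'') \o wenzl i m')) : {linear V -> V})
    else idfun
  else idfun.

Lemma wenzlS i m v : wenzl i m.+2 v =
  wenzl i m.+1 v - (qn m.+1 / qn m.+2) *: wenzl i m.+1 (e (i + m) (wenzl i m.+1 v)).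
Proof. by []. Qed.

Local Arguments wenzl : simpl never.

Lemma wenzl_far i m j v : (j.+1 < i \/ i + m <= j)%N -> (i + m <= N)%N -> (j.+1 < N)%N ->
  e j (wenzl i m v) = wenzl i m (e j v).
Proof.
elim: m v => [|[|m] IHm] v // hj hm jN.
have IH u : e j (wenzl i m.+1 u) = wenzl i m.+1 (e j u) by apply: IHm; lia.
have h : far j (i + m) by rewrite /far; lia.
by rewrite !wenzlS linearB linearZ /= !IH (far_eC _ h) ?IH //; lia.
Qed.

Lemma wenzl_absorb_left (g : {linear V -> V}) i m v :
  (forall j u, (i <= j)%N -> (j.+1 < i + m)%N -> g (e j u) = 0) ->
  g (wenzl i m v) = g v.
Proof.
elim: m g v => [|[|m] IHm] g v // hg.
have hg' j u : (i <= j)%N -> (j.+1 < i + m.+1)%N -> g (e j u) = 0.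
  by move=> h1 h2; apply: hg => //; lia.
rewrite wenzlS linearB linearZ /= !(IHm g) // hg ?scaler0 ?subr0 //; lia.
Qed.

Lemma wenzl_absorb_right i m v :
  (forall j, (i <= j)%N -> (j.+1 < i + m)%N -> e j v = 0) -> wenzl i m v = v.
Proof.
elim: m v => [|[|m] IHm] v // hv.
rewrite wenzlS IHm ?hv ?linear0 ?addr0 //; try lia.
by move=> j h1 h2; apply: hv => //; lia.
Qed.

(** Wenzl's argument. Write P', P'' for the two smaller clasps, and e for
    the last, f for the last but one of the H's. In P' e P' e the second P'
    is expanded by its recursion, and e f e is replaced with e + (f e f -
    f); the bracket dies against P', leaving a multiple of P' e. The scalars
    are such that P e cancels; the same works with e on the other side of P. *)
Lemma wenzl_kill i m : (i + m <= N)%N -> forall j v, (i <= j)%N -> (j.+1 < i + m)%N ->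
  e j (wenzl i m v) = 0 /\ wenzl i m (e j v) = 0.
Proof.
elim: m => [|[|m] IHm] hm j v hij hj; try lia.
have hm' : (i + m.+1 <= N)%N by lia.
have [hlt|hge] := ltnP j (i + m).
  have K u : e j (wenzl i m.+1 u) = 0 /\ wenzl i m.+1 (e j u) = 0.
    by apply: IHm => //; lia.
  have [k1 k2] := K v; rewrite !wenzlS linearB linearZ /= k1 k2.
  by have [-> _] := K (e (i + m) (wenzl i m.+1 v)); rewrite !linear0 !addr0.
have {hij hj hge}-> : j = (i + m)%N by lia.
case: m IHm hm hm' => [|m] IHm hm hm'.
  rewrite !wenzlS /= addn0 linearB linearZ /= e_sqr; last lia.
  by rewrite qn1 qn2 scalerA mul1r mulVf ?scale1r ?subrr -?qn2.
have efe u : e (i + m.+1) (e (i + m) (e (i + m.+1) u)) =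
    e (i + m) (e (i + m.+1) (e (i + m) u)) - e (i + m) u + e (i + m.+1) u.
  by rewrite addnS e_hexagon ?subrK //; lia.
have K u : e (i + m) (wenzl i m.+2 u) = 0 /\ wenzl i m.+2 (e (i + m) u) = 0.
  by apply: IHm => //; lia.
have P1 u : wenzl i m.+2 (wenzl i m.+1 u) = wenzl i m.+2 u.
  apply: wenzl_absorb_left => k w h1 h2; have h3 : (k.+1 < i + m.+2)%N by lia.
  by have [] := IHm hm' k w h1 h3.
have P2 u : wenzl i m.+1 (wenzl i m.+2 u) = wenzl i m.+2 u.
  apply: wenzl_absorb_right => k h1 h2; have h3 : (k.+1 < i + m.+2)%N by lia.
  by have [] := IHm hm' k u h1 h3.
have C u : e (i + m.+1) (wenzl i m.+1 u) = wenzl i m.+1 (e (i + m.+1) u).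
  by apply: wenzl_far; lia.
(* the recursion [m+3] = [2] [m+2] - [m+1], divided by [m+3] *)
have coef : qn m.+2 / qn m.+3 * (t + t^-1 - qn m.+1 / qn m.+2) = 1.
  have h1 := qn_neq0 m.+1; have := qn_neq0 m.+2; rewrite (qnS m.+1) => h2.
  field; rewrite h1 t_neq0 /=.
  have -> : (t * t + 1) * qn m.+2 + - qn m.+1 * t =
    t * ((t + t^-1) * qn m.+2 - qn m.+1) by field.
  exact: mulf_neq0.
have finish u :
    u - (qn m.+2 / qn m.+3) *: ((t + t^-1) *: u - (qn m.+1 / qn m.+2) *: u) = 0.
  by rewrite -scalerBl scalerA coef scale1r subrr.
split.
  rewrite (wenzlS i m.+1 v); set y := wenzl i m.+2 v; rewrite linearB linearZ /=.
  set E := e (i + m.+1) y.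
  suff -> : e (i + m.+1) (wenzl i m.+2 E) =
     (t + t^-1) *: E - (qn m.+1 / qn m.+2) *: E by apply: finish.
  have EE : wenzl i m.+1 E = E by rewrite -C P2.
  rewrite wenzlS linearB linearZ /= EE {1}/E e_sqr; last lia.
  by congr (_ - _ *: _); rewrite C /E efe (proj1 (K _)) !linear0 !add0r -/E EE.
rewrite (wenzlS i m.+1 (e _ _)); set E := e (i + m.+1) v.
suff -> : wenzl i m.+2 (e (i + m.+1) (wenzl i m.+2 E)) =
   (t + t^-1) *: wenzl i m.+2 E - (qn m.+1 / qn m.+2) *: wenzl i m.+2 E by apply: finish.
have -> : e (i + m.+1) (wenzl i m.+2 E) = (t + t^-1) *: wenzl i m.+1 E -
    (qn m.+1 / qn m.+2) *: wenzl i m.+1 (e (i + m.+1) (e (i + m) (wenzl i m.+1 E))).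
  by rewrite (wenzlS i m E) linearB linearZ /= !C /E e_sqr ?linearZ //; lia.
have lin a b X Y : wenzl i m.+2 (a *: wenzl i m.+1 X - b *: wenzl i m.+1 Y) =
    a *: wenzl i m.+2 X - b *: wenzl i m.+2 Y.
  by rewrite linearB !linearZZ !P1.
rewrite lin; congr (_ - _ *: _).
have kill A B X : wenzl i m.+2 (e (i + m) A - e (i + m) B + X) = wenzl i m.+2 X.
  by rewrite linearD linearB !(proj2 (K _)) subr0 add0r.
by rewrite /E -[wenzl i m.+1 _]C efe kill C P1.
Qed.

Definition wenzl2 : {linear V -> V} := wenzl n n \o wenzl 0 n.

Lemma wenzl2_killed v : killed n n (wenzl2 v).
Proof.
move=> i hi hin; have h0 : (0 + n <= N)%N by lia.
rewrite /wenzl2 /=; have [hlt|hge] := ltnP i.+1 n.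
  rewrite wenzl_far; try lia.
  by have [-> _] := wenzl_kill h0 v (leq0n i) hlt; rewrite linear0.
have h1 : (n <= i)%N by lia.
by have [] := wenzl_kill nN (wenzl 0 n v) h1 hi.
Qed.

Lemma wenzl2_kills i v : (i.+1 < n + n)%N -> i.+1 != n -> wenzl2 (e i v) = 0.
Proof.
move=> hi hin; have h0 : (0 + n <= N)%N by lia.
rewrite /wenzl2 /=; have [hlt|hge] := ltnP i.+1 n.
  by have [_ ->] := wenzl_kill h0 v (leq0n i) hlt; rewrite linear0.
have h1 : (n <= i)%N by lia.
rewrite -wenzl_far; try lia.
by have [] := wenzl_kill nN (wenzl 0 n v) h1 hi.
Qed.

End Clasp.
End HeckeAction.

(** * The coefficients along a chain *)

(** Both the sums and the products in chi have a summand for each step of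
    the chain, so removing the first step is one statement for all of them. *)
Lemma big_chain (R : Type) (idx : R) (op : R -> R -> R) (g : nat -> nat -> R) k l ks :
  \big[op/idx]_(1 <= i < (size (l :: ks)).+1)
     g (nth 0%N (k :: l :: ks) i.-1) (nth 0%N (k :: l :: ks) i) =
  op (g k l) (\big[op/idx]_(1 <= i < (size ks).+1)
     g (nth 0%N (l :: ks) i.-1) (nth 0%N (l :: ks) i)).
Proof.
rewrite [LHS]big_add1 [in RHS]big_add1 /= big_ltn //; congr op.
by rewrite big_add1.
Qed.

(** Here q e stands for q^(e/6), so that q 6 is the variable of the
    q-factorials. *)
Section Chi.
Variables (F : fieldType) (q : int -> F).
Hypothesis qD : forall a b, q (a + b) = q a * q b.
Hypothesis q0 : q 0 = 1.
Local Notation qp := (poch (q 6)).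
Hypothesis qp_neq0 : forall k, qp k != 0.

Lemma q_neq0 a : q a != 0.
Proof.
apply/eqP=> h; have := qD a (- a); rewrite subrr q0 h mul0r => /eqP.
by rewrite oner_eq0.
Qed.

Lemma qN a : q (- a) = (q a)^-1.
Proof. by apply: (mulIf (q_neq0 a)); rewrite -qD addNr q0 mulVf ?q_neq0. Qed.

Lemma qX a k : q a ^+ k = q (a * k%:Z).
Proof.
elim: k => [|k IHk]; first by rewrite mulr0 q0.
by rewrite exprS IHk -qD; congr q; rewrite intS mulrDr mulr1.
Qed.

(** The coefficient of the theorem, except that the chain starts at k0
    instead of n; only then does it factor along the chain. *)
Definition gchi_pos (n k0 : nat) (ks : seq nat) : F :=
  let m := size ks in
  let k i := nth 0%N (k0 :: ks) i in
  (-1) ^+ (n * m) *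
  (q (- ((n%:Z ^+ 2 + 3 * n%:Z) * m%:Z)) * q (3 * (k0%:Z - (k m)%:Z)) *
   (-1) ^+ (\sum_(1 <= i < m.+1) k i)%N *
   q (\sum_(1 <= i < m.+1) 3 * ((k i)%:Z ^+ 2 + (k i)%:Z)) * qp k0) /
  ((\prod_(1 <= i < m.+1) qp (k i.-1 - k i)) * qp (k m)).

Definition gchi_neg (n k0 : nat) (ks : seq nat) : F :=
  let r := size ks in
  let k i := nth 0%N (k0 :: ks) i in
  (-1) ^+ (n * r) *
  (q ((n%:Z ^+ 2 + 3 * n%:Z) * r%:Z) * q (- (3 * (k0%:Z - (k r)%:Z))) *
   (-1) ^+ (\sum_(1 <= i < r.+1) k i)%N *
   q (\sum_(1 <= i < r.+1) 3 * ((k i)%:Z ^+ 2 - (k i)%:Z)) *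
   q (- (\sum_(1 <= i < r.+1) 6 * ((k i.-1)%:Z * (k i)%:Z))) * qp k0) /
  ((\prod_(1 <= i < r.+1) qp (k i.-1 - k i)) * qp (k r)).

(** The ratio of the coefficients of k :: l :: ks and l :: ks. *)
Definition step_pos (n k l : nat) : F :=
  (-1) ^+ (n + l) *
  q (- (n%:Z ^+ 2 + 3 * n%:Z) + 3 * (k%:Z - l%:Z) + 3 * (l%:Z ^+ 2 + l%:Z)) *
  (qp k / (qp (k - l) * qp l)).

Definition step_neg (n k l : nat) : F :=
  (-1) ^+ (n + l) *
  q (n%:Z ^+ 2 + 3 * n%:Z - 3 * (k%:Z - l%:Z) + 3 * (l%:Z ^+ 2 - l%:Z)
    - 6 * (k%:Z * l%:Z)) *
  (qp k / (qp (k - l) * qp l)).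

Lemma gchi_pos_nil n k : gchi_pos n k [::] = 1.
Proof.
by rewrite /gchi_pos /= !big_geq // muln0 mulr0 oppr0 subrr mulr0 q0 !mul1r mulfV.
Qed.

Lemma gchi_neg_nil n k : gchi_neg n k [::] = 1.
Proof.
by rewrite /gchi_neg /= !big_geq // muln0 mulr0 oppr0 subrr mulr0 oppr0 q0 !mul1r mulfV.
Qed.

Lemma gchi_pos_cons n k l ks : gchi_pos n k (l :: ks) = step_pos n k l * gchi_pos n l ks.
Proof.
rewrite /gchi_pos.
rewrite (big_chain _ _ (fun _ b => b)).
rewrite (big_chain _ _ (fun _ b => 3 * (b%:Z ^+ 2 + b%:Z))).
rewrite (big_chain _ _ (fun a b => qp (a - b))).
set S1 := (\sum_(_ <= i < _) _)%N; set S2 := \sum_(_ <= i < _) _.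
set P := \prod_(_ <= i < _) _.
rewrite [nth _ _ (size (l :: ks))]/= [size _]/=; set z := nth 0%N _ _; set m := size ks.
have P0 : P != 0 by rewrite prodf_seq_neq0; apply/allP => i _; rewrite qp_neq0.
have eq1 : q (- ((n%:Z ^+ 2 + 3 * n%:Z) * m.+1%:Z)) * q (3 * (k%:Z - z%:Z)) *
    q (3 * (l%:Z ^+ 2 + l%:Z) + S2) =
    q (- (n%:Z ^+ 2 + 3 * n%:Z) + 3 * (k%:Z - l%:Z) + 3 * (l%:Z ^+ 2 + l%:Z)) *
    q (- ((n%:Z ^+ 2 + 3 * n%:Z) * m%:Z)) * q (3 * (l%:Z - z%:Z)) * q S2.
  by rewrite -!qD; congr q; rewrite intS; ring.
rewrite /step_pos mulnS !exprD.
transitivity (((-1) ^+ n * (-1) ^+ (n * m) * (-1) ^+ l * (-1) ^+ S1) *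
  (q (- ((n%:Z ^+ 2 + 3 * n%:Z) * m.+1%:Z)) * q (3 * (k%:Z - z%:Z)) *
    q (3 * (l%:Z ^+ 2 + l%:Z) + S2)) * (qp k / (qp (k - l) * P * qp z))).
  by ring.
rewrite eq1; field.
by rewrite !qp_neq0 P0.
Qed.

Lemma gchi_neg_cons n k l ks : gchi_neg n k (l :: ks) = step_neg n k l * gchi_neg n l ks.
Proof.
rewrite /gchi_neg.
rewrite (big_chain _ _ (fun _ b => b)).
rewrite (big_chain _ _ (fun _ b => 3 * (b%:Z ^+ 2 - b%:Z))).
rewrite (big_chain _ _ (fun a b => 6 * (a%:Z * b%:Z))).
rewrite (big_chain _ _ (fun a b => qp (a - b))).
set S1 := (\sum_(_ <= i < _) _)%N; set S2 := \sum_(_ <= i < _) _.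
set S3 := \sum_(_ <= i < _) (6 * _); set P := \prod_(_ <= i < _) _.
rewrite [nth _ _ (size (l :: ks))]/= [size _]/=; set z := nth 0%N _ _; set m := size ks.
have P0 : P != 0 by rewrite prodf_seq_neq0; apply/allP => i _; rewrite qp_neq0.
have eq1 : q ((n%:Z ^+ 2 + 3 * n%:Z) * m.+1%:Z) * q (- (3 * (k%:Z - z%:Z))) *
    q (3 * (l%:Z ^+ 2 - l%:Z) + S2) * q (- (6 * (k%:Z * l%:Z) + S3)) =
    q (n%:Z ^+ 2 + 3 * n%:Z - 3 * (k%:Z - l%:Z) + 3 * (l%:Z ^+ 2 - l%:Z)
      - 6 * (k%:Z * l%:Z)) *
    q ((n%:Z ^+ 2 + 3 * n%:Z) * m%:Z) * q (- (3 * (l%:Z - z%:Z))) * q S2 * q (- S3).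
  by rewrite -!qD; congr q; rewrite intS; ring.
rewrite /step_neg mulnS !exprD.
transitivity (((-1) ^+ n * (-1) ^+ (n * m) * (-1) ^+ l * (-1) ^+ S1) *
  (q ((n%:Z ^+ 2 + 3 * n%:Z) * m.+1%:Z) * q (- (3 * (k%:Z - z%:Z))) *
    q (3 * (l%:Z ^+ 2 - l%:Z) + S2) * q (- (6 * (k%:Z * l%:Z) + S3))) *
    (qp k / (qp (k - l) * P * qp z))).
  by ring.
rewrite eq1; field.
by rewrite !qp_neq0 P0.
Qed.

Lemma signr_sqr n : (-1) ^+ (n * n) = (-1) ^+ n :> F.
Proof. by rewrite -signr_odd oddM andbb signr_odd. Qed.

Lemma twist_coef_pos n k l : (k <= n)%N -> (l <= k)%N ->
  (- q (- 1)) ^+ (n * n) * twist_coef (q 3) n k l = step_pos n k l.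
Proof.
move=> hk hl; rewrite /twist_coef /mixed_coef.
have -> : qbin (q 3 ^+ 2) k l = qp k / (qp (k - l) * qp l).
  rewrite qX; apply: (mulIf (mulf_neq0 (qp_neq0 (k - l)) (qp_neq0 l))).
  by rewrite qbin_poch // divfK ?mulf_neq0.
rewrite [(- q _) ^+ _]exprNn signr_sqr /step_pos exprD -qN !qX.
have e1 : q (-1 * (n * n)%N%:Z) * q (-3 * (n - k)%N%:Z) * q (3 * (l ^ 2)%N%:Z) =
    q (- (n%:Z ^+ 2 + 3 * n%:Z) + 3 * (k%:Z - l%:Z) + 3 * (l%:Z ^+ 2 + l%:Z)).
  rewrite -!qD; congr q; rewrite -subzn // expnS expn1 !PoszM; ring.
by rewrite -e1; ring.
Qed.

(** The q-factorial under q -> q^-1; it accounts for the exponents of chi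
    that appear only for negative twists. *)
Lemma poch_inv k : poch (q (- 6)) k =
  (-1) ^+ k * q (- (3 * (k%:Z ^+ 2 + k%:Z))) * qp k.
Proof.
elim: k => [|k IHk]; first by rewrite !poch0 expr0 expr0n /= addr0 mulr0 oppr0 q0 !mulr1.
rewrite !pochS IHk !qX [(-1) ^+ k.+1]exprS.
have e1 : q (- (3 * (k.+1%:Z ^+ 2 + k.+1%:Z))) =
    q (- (3 * (k%:Z ^+ 2 + k%:Z))) * q (- 6 * k.+1%:Z).
  by rewrite -qD; congr q; rewrite intS; ring.
have e2 : q (6 * k.+1%:Z) * q (- 6 * k.+1%:Z) = 1 by rewrite -qD mulNr subrr q0.
have gen (x y : F) : y * x = 1 -> 1 - x = - x * (1 - y).
  by move=> h; rewrite mulrBr mulr1 mulNr opprK [x * y]mulrC h addrC.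
have e3 : 1 - q (- 6 * k.+1%:Z) = - q (- 6 * k.+1%:Z) * (1 - q (6 * k.+1%:Z)).
  exact: gen.
by rewrite e1 e3; ring.
Qed.

Lemma twist_coef_neg n k l : (k <= n)%N -> (l <= k)%N ->
  (- q 1) ^+ (n * n) * twist_coef (q (- 3)) n k l = step_neg n k l.
Proof.
move=> hk hl; rewrite /twist_coef /mixed_coef.
have -> : qbin (q (- 3) ^+ 2) k l =
    q (- (6 * (l%:Z * (k%:Z - l%:Z)))) * (qp k / (qp (k - l) * qp l)).
  have h6 : q (- 3) ^+ 2 = q (- 6) by rewrite qX.
  have nz j : poch (q (- 6)) j != 0.
    by rewrite poch_inv !mulf_neq0 ?qp_neq0 ?q_neq0 // signr_eq0.
  apply: (mulIf (mulf_neq0 (nz (k - l)%N) (nz l))).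
  rewrite h6 qbin_poch // !poch_inv.
  have -> : (-1) ^+ k = (-1) ^+ (k - l) * (-1) ^+ l :> F by rewrite -exprD subnK.
  have -> : q (- (3 * (k%:Z ^+ 2 + k%:Z))) = q (- (6 * (l%:Z * (k%:Z - l%:Z)))) *
     q (- (3 * ((k - l)%N%:Z ^+ 2 + (k - l)%N%:Z))) * q (- (3 * (l%:Z ^+ 2 + l%:Z))).
    by rewrite -!qD; congr q; rewrite -subzn //; ring.
  by field; rewrite !qp_neq0.
rewrite [(- q _) ^+ _]exprNn signr_sqr /step_neg exprD -qN !qX.
have e1 : q (1 * (n * n)%N%:Z) * q (- - 3 * (n - k)%N%:Z) * q (- 3 * (l ^ 2)%N%:Z) *
    q (- (6 * (l%:Z * (k%:Z - l%:Z)))) =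
    q (n%:Z ^+ 2 + 3 * n%:Z - 3 * (k%:Z - l%:Z) + 3 * (l%:Z ^+ 2 - l%:Z)
      - 6 * (k%:Z * l%:Z)).
  rewrite -!qD; congr q; rewrite -subzn // expnS expn1 !PoszM; ring.
by rewrite -e1; ring.
Qed.

(** b is the scalar that one half twist contributes besides its matrix c. *)
Lemma chain_closed (c G : nat -> nat -> F) (C : nat -> seq nat -> F) n b :
  (forall k l, (k <= n)%N -> (l <= k)%N -> b * c k l = G k l) ->
  (forall k, C k [::] = 1) -> (forall k l ks, C k (l :: ks) = G k l * C l ks) ->
  forall k ks, (k <= n)%N -> path geq k ks -> b ^+ size ks * chain c k ks = C k ks.
Proof.
move=> hc h0 hS k ks; elim: ks k => [|l ks IHks] k hk /=; first by rewrite h0 mulr1.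
case/andP=> hl hp; rewrite hS -IHks //; last exact: leq_trans hl hk.
by rewrite -hc // exprS; ring.
Qed.

Lemma chain_pos n ks : path geq n ks ->
  (- q (- 1)) ^+ (n * n) ^+ size ks * chain (twist_coef (q 3) n) n ks = gchi_pos n n ks.
Proof.
apply: (@chain_closed _ (step_pos n) (gchi_pos n) n) => //.
- by move=> k l; apply: twist_coef_pos.
- exact: gchi_pos_nil.
- exact: gchi_pos_cons.
Qed.

Lemma chain_neg n ks : path geq n ks ->
  (- q 1) ^+ (n * n) ^+ size ks * chain (twist_coef (q (- 3)) n) n ks = gchi_neg n n ks.
Proof.
apply: (@chain_closed _ (step_neg n) (gchi_neg n) n) => //.
- by move=> k l; apply: twist_coef_neg.
- exact: gchi_neg_nil.
- exact: gchi_neg_cons.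
Qed.

End Chi.

(** * Moves on words *)

Section WordEquivalence.

Lemma shift_cat i u v : shift i (u ++ v) = shift i u ++ shift i v.
Proof. exact: map_cat. Qed.

Lemma shift_shift i j w : shift i (shift j w) = shift (i + j) w.
Proof. by rewrite /shift -map_comp; apply: eq_map => e /=; rewrite addnA. Qed.

Lemma shift0 w : shift 0 w = w.
Proof. by rewrite /shift -[RHS]map_id; apply: eq_map => -[]. Qed.

Lemma run_shift x y a b w : run a w = Some b ->
  run (x ++ a ++ y) (shift (size x) w) = Some (x ++ b ++ y).
Proof. by move/eqP=> h; apply/eqP; apply: is_web_shift. Qed.

Lemma class_local a b u x p y v l r :
  run a u = Some (x ++ p ++ y) -> local_rel p l r ->
  web_class a b (web (u ++ shift (size x) l ++ v)) =
  \sum_(cw <- r) cw.1 *: web_class a b (web (u ++ shift (size x) cw.2 ++ v)).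
Proof.
move=> hu hr; have /web_classP -> := rel_local b v hu hr.
by rewrite linear_sum; apply: eq_bigr => cw _; rewrite linearZ.
Qed.

(** Equality of webs that can be used inside larger ones: the strands p may
    be part of a wider web, with u below, v above, x on the left and y on
    the right. *)
Definition weq p (l r : word) := forall a b u x y v,
  run a u = Some (x ++ p ++ y) ->
  web_class a b (web (u ++ shift (size x) l ++ v)) =
  web_class a b (web (u ++ shift (size x) r ++ v)).

Lemma weq_iso p l r : isotopy p l r -> weq p l r.
Proof.
move=> h a b u x y v hu; rewrite (class_local b v hu (r := [:: (1, r)])).
  by rewrite big_seq1 scale1r.
by left; exists r.
Qed.

Lemma weq_sym p l r : weq p l r -> weq p r l.
Proof. by move=> h a b u x y v hu; rewrite (h a b u x y v hu). Qed.

Lemma weq_trans p l m r : weq p l m -> weq p m r -> weq p l r.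
Proof.
by move=> h1 h2 a b u x y v hu; rewrite (h1 a b u x y v hu) (h2 a b u x y v hu).
Qed.

Lemma weq_at p u x p' y l r v : run p u = Some (x ++ p' ++ y) -> weq p' l r ->
  weq p (u ++ shift (size x) l ++ v) (u ++ shift (size x) r ++ v).
Proof.
move=> hu h a b u0 x0 y0 v0 hu0.
rewrite !shift_cat !shift_shift -!catA !(catA u0) -size_cat.
apply: (h a b _ _ (y ++ y0)).
by rewrite run_cat hu0 /= (run_shift x0 y0 hu) -!catA.
Qed.

Lemma weq_in p u x y v p' l r : weq p' l r -> run p u = Some (x ++ p' ++ y) ->
  weq p (u ++ shift (size x) l ++ v) (u ++ shift (size x) r ++ v).
Proof. by move=> h hu; apply: weq_at hu h. Qed.
Arguments weq_in : clear implicits.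

Lemma weq_left p u p' l r : run p u = Some p' -> weq p' l r -> weq p (u ++ l) (u ++ r).
Proof.
move=> hu h; have := @weq_at p u [::] p' [::] l r [::]; rewrite cats0 /= => /(_ hu h).
by rewrite !shift0 !cats0.
Qed.

Lemma weq_right p l r v : weq p l r -> weq p (l ++ v) (r ++ v).
Proof.
move=> h; have := @weq_at p [::] [::] p [::] l r v; rewrite cats0 /= => /(_ erefl h).
by rewrite !shift0.
Qed.

Lemma weq_shift x y p l r : weq p l r ->
  weq (x ++ p ++ y) (shift (size x) l) (shift (size x) r).
Proof.
by move=> h; have := @weq_at _ [::] x p y l r [::] erefl h; rewrite /= !cats0.
Qed.

(** The exchange of heights of two pieces, iterated over the pieces of a
    web. *)
Lemma weq_slide g z p q w : run p w = Some q ->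
  weq (bot g ++ z ++ p) ((0, g) :: shift (size (top g) + size z) w)
    (shift (size (bot g) + size z) w ++ [:: (0, g)])%N.
Proof.
elim: w p => [|[i h] w IHw] p //; rewrite run_cons.
case E: (step p (i, h)) => [p'|] //= /IHw {}IHw.
have [x [y [Ep Ep' Ei]]] := stepP E; rewrite {p E}Ep {p'}Ep' -{i}Ei in IHw *.
set lw := shift _ _ in IHw *; set rw := (shift _ w) in IHw *.
have ex := weq_iso (iso_exchange g h (z ++ x)).
have := @weq_at (bot g ++ z ++ x ++ bot h ++ y) [::] [::] _ y _ _ lw _ ex.
rewrite /= -!catA !size_cat !addnA => /(_ erefl); rewrite !add0n => ex'.
apply: weq_trans ex' _.
apply: (@weq_left _ [:: ((size (bot g) + size z + size x)%N, h)] _ _ _ _ IHw).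
by rewrite run_cons !(catA _ x) !(catA (bot g)) step_piece ?size_cat ?addnA //=.
Qed.

Local Open Scope nat_scope.

(** The relations only turn legs of merging vertices; bending one of the
    strands with a cup and straightening a zigzag turns a leg of a splitting
    vertex. *)
Lemma weq_split_right s : weq [:: s] [:: (0, Split s)] [:: (1, Cup s); (0, Merge s)].
Proof.
have turn := weq_iso (iso_turn_right s).
have exch := weq_iso (iso_exchange (Split s) (Cup s) [::]).
have zz := weq_iso (iso_zigzag_left (~~ s)); rewrite negbK in zz.
apply/weq_sym.
apply: (@weq_trans _ _ [:: (1, Cup s); (0, Split s); (1, Cap (~~ s))]).
  apply: (@weq_at _ [:: (1, Cup s)] [::] _ [:: ~~ s] _ _ [::] _ (weq_sym turn)).
  by case: (s).
apply: (@weq_trans _ _ [:: (0, Split s); (2, Cup s); (1, Cap (~~ s))]).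
  by apply: (@weq_at _ [::] [::] _ [::] _ _ [:: (1, Cap (~~ s))] _ (weq_sym exch)).
apply: (@weq_at _ [:: (0, Split s)] [:: ~~ s] _ [::] _ _ [::] _ zz).
by case: (s).
Qed.

Lemma weq_split_left s : weq [:: s] [:: (0, Split s)] [:: (0, Cup (~~ s)); (1, Merge s)].
Proof.
have turn := weq_iso (iso_turn_left s).
have exch := weq_iso (iso_exchange (Cup (~~ s)) (Split s) [::]).
have zz := weq_iso (iso_zigzag_right (~~ s)); rewrite negbK in zz.
apply/weq_sym.
apply: (@weq_trans _ _ [:: (0, Cup (~~ s)); (2, Split s); (1, Cap s)]).
  apply: (@weq_at _ [:: (0, Cup (~~ s))] [:: ~~ s] _ [::] _ _ [::] _ (weq_sym turn)).
  by case: (s).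
apply: (@weq_trans _ _ [:: (0, Split s); (0, Cup (~~ s)); (1, Cap s)]).
  by apply: (@weq_at _ [::] [::] _ [::] _ _ [:: (1, Cap s)] _ exch).
apply: (@weq_at _ [:: (0, Split s)] [::] _ [:: ~~ s] _ _ [::] _ zz).
by case: (s).
Qed.

(** An H lying on its side can be drawn with either of its vertices lower.
    The square face found in H_i H_(i+1) H_i differs from that of the square
    relation in this way. *)
Lemma weq_side : weq [:: true; false]
  [:: (1, Split false); (0, Merge true)] [:: (0, Split true); (1, Merge false)].
Proof.
apply: (@weq_trans _ _ [:: (1, Split false); (0, Split true); (1, Cap false)]).
  exact: (weq_in [:: true; false] [:: (1, Split false)] [::] [:: true] [::] _ _ _
    (weq_sym (weq_iso (iso_turn_right true))) erefl).
apply: (@weq_trans _ _ [:: (0, Split true); (2, Split false); (1, Cap false)]).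
  exact: (weq_in [:: true; false] [::] [::] [::] [:: (1, Cap false)] _ _ _
    (weq_sym (weq_iso (iso_exchange (Split true) (Split false) [::]))) erefl).
exact: (weq_in [:: true; false] [:: (0, Split true)] [:: false] [::] [::] _ _ _
    (weq_iso (iso_turn_left false)) erefl).
Qed.

(** Three strands ending in a sink, drawn so that the first two (index 0) or
    the last two (index 1) of them meet first. *)
Definition three_in (i : nat) : word :=
  if i is 0 then [:: (0, Merge true); (0, Cap false)]
  else [:: (1, Merge true); (0, Cap true)].
Definition three_out (i : nat) : word :=
  if i is 0 then [:: (0, Cup false); (0, Split false)]
  else [:: (0, Cup true); (1, Split false)].

Lemma weq_three_in : weq [:: true; true; true] (three_in 0) (three_in 1).
Proof.
rewrite /three_in /three_out.
apply: (@weq_trans _ _ [:: (1, Split true); (0, Cap true); (0, Cap false)]).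
  exact: (weq_in [:: true; true; true] [::] [::] [:: true] [:: (0, Cap false)] _ _ _
    (weq_sym (weq_iso (iso_turn_left true))) erefl).
apply: (@weq_trans _ _ [:: (1, Split true); (2, Cap false); (0, Cap true)]).
  exact: (weq_in [:: true; true; true] [:: (1, Split true)] [::] [::] [::] _ _ _
    (weq_iso (iso_exchange (Cap true) (Cap false) [::])) erefl).
exact: (weq_in [:: true; true; true] [::] [:: true] [::] [:: (0, Cap true)] _ _ _
    (weq_iso (iso_turn_right true)) erefl).
Qed.

Lemma weq_three_out : weq [::] (three_out 0) (three_out 1).
Proof.
rewrite /three_in /three_out.
apply: (@weq_trans _ _ [:: (0, Cup false); (0, Cup true); (1, Merge false)]).
  exact: (weq_in [::] [:: (0, Cup false)] [::] [:: true] [::] _ _ _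
    (@weq_split_left false) erefl).
apply: (@weq_trans _ _ [:: (0, Cup true); (2, Cup false); (1, Merge false)]).
  exact: (weq_in [::] [::] [::] [::] [:: (1, Merge false)] _ _ _
    (weq_sym (weq_iso (iso_exchange (Cup true) (Cup false) [::]))) erefl).
exact: (weq_in [::] [:: (0, Cup true)] [:: true] [::] [::] _ _ _
    (weq_sym (@weq_split_right false)) erefl).
Qed.

Lemma weq_three :
  weq [:: true; true; true] (three_in 0 ++ three_out 0) (three_in 1 ++ three_out 1).
Proof.
apply: (@weq_trans _ _ (three_in 0 ++ three_out 1)).
  exact: weq_left weq_three_out.
exact: weq_right weq_three_in.
Qed.

Local Open Scope ring_scope.

Lemma sum_two (R : pzRingType) (V : lmodType R) (f : word -> V) w1 w2 :
  \sum_(cw <- [:: (1 : R, w1); (1, w2)]) cw.1 *: f cw.2 = f w1 + f w2.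
Proof. by rewrite big_cons big_seq1 !scale1r. Qed.

Lemma class_square a b s u x y v : run a u = Some (x ++ [:: s; ~~ s] ++ y) ->
  web_class a b (web (u ++ shift (size x) [:: (0, Split s); (1, Merge (~~ s));
    (0, Split (~~ s)); (1, Merge s)]%N ++ v)) =
  web_class a b (web (u ++ v)) +
  web_class a b (web (u ++ shift (size x) [:: (0, Cap s); (0, Cup s)]%N ++ v)).
Proof.
move=> hu; rewrite (class_local b v hu (or_intror (skein_square s))).
exact: (sum_two (fun w => web_class a b (web (u ++ shift (size x) w ++ v)))).
Qed.

(** H_0 H_1 H_0 has a square face between the two factors H_0. One smoothing
    gives back H_0, the other the web of three_in and three_out. *)
Lemma square_left a b u x y v : run a u = Some (x ++ [:: true; true; true] ++ y) ->
  web_class a b (web (u ++ shift (size x) (Hword 0 ++ Hword 1 ++ Hword 0) ++ v)) =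
  web_class a b (web (u ++ shift (size x) (Hword 0) ++ v)) +
  web_class a b (web (u ++ shift (size x) (three_in 0 ++ three_out 0) ++ v)).
Proof.
move=> hu.
have side := weq_in [:: true; true; true]
  [:: (0, Merge true); (0, Split false); (1, Merge true)]%N [::] [::]
  [:: (0, Split false)]%N _ _ _ weq_side erefl.
rewrite (side _ _ _ _ _ _ hu).
have hu' : run a (u ++ shift (size x) [:: (0, Merge true)]%N) =
    Some (x ++ [:: false; true] ++ y).
  rewrite run_cat hu /=.
  exact: (@run_shift x y [:: true; true; true] [:: false; true] [:: (0, Merge true)]%N).
have := class_square b (shift (size x) [:: (0, Split false)]%N ++ v) hu'.
by rewrite -!catA.
Qed.

Lemma square_right a b u x y v : run a u = Some (x ++ [:: true; true; true] ++ y) ->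
  web_class a b (web (u ++ shift (size x) (Hword 1 ++ Hword 0 ++ Hword 1) ++ v)) =
  web_class a b (web (u ++ shift (size x) (Hword 1) ++ v)) +
  web_class a b (web (u ++ shift (size x) (three_in 1 ++ three_out 1) ++ v)).
Proof.
move=> hu.
have side := weq_in [:: true; true; true]
  [:: (1, Merge true)]%N [::] [::]
  [:: (0, Split false); (1, Merge true); (1, Split false)]%N _ _ _ weq_side erefl.
rewrite (side _ _ _ _ _ _ hu).
have hu' : run a (u ++ shift (size x) [:: (1, Merge true)]%N) =
    Some (x ++ [:: true; false] ++ y).
  rewrite run_cat hu /=.
  exact: (@run_shift x y [:: true; true; true] [:: true; false] [:: (1, Merge true)]%N).
have := class_square b (shift (size x) [:: (1, Split false)]%N ++ v) hu'.
by rewrite -!catA.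
Qed.

End WordEquivalence.

(** * The right action of H_i on the web space *)

Section RightAction.

Lemma run_Hword c b i : run c (Hword i) = Some b -> c = b.
Proof.
rewrite /Hword run_cons; case E: (step c (i, Merge true)) => [d|] //=.
have [x [y [-> -> Ei]]] := stepP E.
by rewrite run_cons (@step_piece x (Split false) y) //= => -[].
Qed.

(** A word that is no web from a to b might become one after multiplication;
    this cannot happen for H_i, which leaves the signs of the strands
    unchanged. *)
Lemma web_rel_mulH a b i f : web_rel a b f -> web_rel a b (f * web (Hword i)).
Proof.
elim=> [|f' g _ IHf _ IHg|c f' _ IHf|w hw|u x p y v l r hu hl].
- by rewrite mul0r; apply: rel_zero.
- by rewrite mulrDl; apply: rel_add.
- by rewrite -scalerAl; apply: rel_scale.
- rewrite webM; apply: rel_notweb; apply: contra hw; rewrite /is_web run_cat.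
  by case: (run a w) => //= c /eqP /run_Hword ->.
- rewrite mulrBl mulr_suml webM -!catA.
  have := rel_local b (v ++ Hword i) hu hl.
  congr (web_rel a b (_ - _)); apply: eq_bigr => cw _.
  by rewrite -scalerAl webM -!catA.
Qed.

Variables a : seq bool.
Local Notation V := (web_space a a).

(** The class of f times H_i depends on the class of f only (hact_class), so
    any representative will do. *)
Definition hact (i : nat) (x : V) : V := web_class a a ((repr x : comb) * web (Hword i)).

Lemma hact_class i f : hact i (web_class a a f) = web_class a a (f * web (Hword i)).
Proof.
apply/web_classP; rewrite -mulrBl; apply: web_rel_mulH.
by apply/web_classP; rewrite web_class_repr.
Qed.

Lemma hact_is_linear i : linear (hact i).
Proof.
move=> c x y; rewrite -[x]web_class_repr -[y]web_class_repr.
by rewrite !(hact_class, =^~ linearP) mulrDl scalerAl.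
Qed.

HB.instance Definition _ i := GRing.isLinear.Build K V V _ (hact i) (hact_is_linear i).

Lemma web_space_ext (wordvec : lmodType K) (g h : {linear V -> wordvec}) :
  (forall w, is_web a a w -> g (web_class a a (web w)) = h (web_class a a (web w))) ->
  g =1 h.
Proof.
move=> gh x; rewrite -[x]web_class_repr; set f := (repr x : comb).
rewrite (monalgE f) !linear_sum; apply: eq_bigr => w _.
have -> : << f@_w *g w >> = f@_w *: web w.
  by apply/malgP=> k; rewrite mcoeffZ !mcoeffU mulrnAr mulr1.
rewrite !linearZ /=; congr (_ *: _).
have [/gh //|/negP nw] := boolP (is_web a a w).
suff -> : web_class a a (web w) = 0 by rewrite !linear0.
rewrite -(linear0 (web_class a a)); apply/web_classP; rewrite subr0.
by apply: rel_notweb; apply/negP.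
Qed.

End RightAction.

Section HeckeRelations.
Variable N : nat.
Local Notation a := (ups N).
Local Notation V := (web_space a a).
Local Notation e := (@hact a).

Lemma ups_split i k : (i + k <= N)%N -> a = ups i ++ ups k ++ ups (N - (i + k)).
Proof. by move=> h; rewrite /ups -!nseqD addnA subnKC. Qed.

Lemma Hword_shift i k : Hword (i + k) = shift i (Hword k).
Proof. by []. Qed.

Lemma run_web w : is_web a a w -> run a w = Some a.
Proof. by move/eqP. Qed.

Lemma hact_web i w : e i (web_class a a (web w)) = web_class a a (web (w ++ Hword i)).
Proof. by rewrite hact_class webM. Qed.

Lemma hact_bigon i v : (i.+1 < N)%N -> e i (e i v) = qint 2 *: e i v.
Proof.
move=> hi; apply: (@web_space_ext a _ (e i \o e i) (qint 2 \*: e i)) => w hw.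
rewrite [LHS]/= [RHS]/= !hact_web -!catA.
have hu : run a (w ++ shift (size (ups i)) [:: (0, Merge true)]%N) =
    Some (ups i ++ [:: false] ++ ups (N - (i + 2))).
  rewrite run_cat (run_web hw) /= {1}(@ups_split i 2); last lia.
  exact: (@run_shift (ups i) _ (ups 2) [:: false] [:: (0, Merge true)]%N).
have := class_local a (shift (size (ups i)) [:: (0, Split false)]%N) hu
  (or_intror (skein_bigon false)).
rewrite big_seq1 size_nseq /shift /= !addn0 -!catA; exact.
Qed.

(** After the square relation both sides are the same web, a sink below a
    source, with the vertices drawn in two ways. *)
Lemma hact_braid i v : (i.+2 < N)%N ->
  e i (e i.+1 (e i v)) - e i v = e i.+1 (e i (e i.+1 v)) - e i.+1 v.
Proof.
move=> hi; apply: (@web_space_ext a _ ((e i \o (e i.+1 \o e i)) \- e i)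
  ((e i.+1 \o (e i \o e i.+1)) \- e i.+1)) => w hw.
rewrite [LHS]/= [RHS]/= !hact_web -!catA.
have hu : run a w = Some (ups i ++ ups 3 ++ ups (N - (i + 3))).
  by rewrite (run_web hw) -ups_split //; lia.
have := square_left a [::] hu; have := square_right a [::] hu.
have := weq_three a [::] hu.
rewrite !cats0 !shift_cat size_nseq -!Hword_shift addn0 addn1.
by move=> -> -> ->; rewrite [LHS]addrC addKr [RHS]addrC addKr.
Qed.

Lemma weq_far z : weq (ups 2 ++ z ++ ups 2) (Hword 0 ++ Hword (2 + size z))
  (Hword (2 + size z) ++ Hword 0).
Proof.
have h1 := @weq_slide (Split false) z (ups 2) (ups 2) (Hword 0) erefl.
have h2 := @weq_slide (Merge true) z (ups 2) (ups 2) (Hword 0) erefl.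
have -> : Hword (2 + size z) = shift (2 + size z) (Hword 0).
  by rewrite -Hword_shift addn0.
have hu : run (ups 2 ++ z ++ ups 2) [:: (0, Merge true)]%N =
    Some ([:: false] ++ z ++ ups 2).
  exact: (@run_shift [::] (z ++ ups 2) (ups 2) [:: false] [:: (0, Merge true)]%N).
apply: weq_trans (weq_left hu h1) _.
by have := weq_right [:: (0, Split false)]%N h2; rewrite -catA.
Qed.

Lemma hact_far i j v : (i.+1 < j)%N -> (j.+1 < N)%N -> e i (e j v) = e j (e i v).
Proof.
move=> hij hj; apply: (@web_space_ext a _ (e i \o e j) (e j \o e i)) => w hw.
rewrite [LHS]/= [RHS]/= !hact_web -!catA.
have hu : run a w = Some (ups i ++ (ups 2 ++ ups (j - i.+2) ++ ups 2) ++ ups (N - j.+2)).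
  rewrite (run_web hw) /ups -!nseqD; congr (Some (nseq _ _)); lia.
have := weq_far a [::] hu.
rewrite !cats0 !shift_cat !size_nseq -!Hword_shift addn0.
by have -> : (i + (2 + (j - i.+2)) = j)%N by lia.
Qed.

End HeckeRelations.

(** * Triangles as products of H's *)

Section Stem.
Local Open Scope nat_scope.

Definition Hwords (s : seq nat) : word := flatten [seq Hword i | i <- s].

Lemma Hwords_cat s1 s2 : Hwords (s1 ++ s2) = Hwords s1 ++ Hwords s2.
Proof. by rewrite /Hwords map_cat flatten_cat. Qed.

Lemma Hwords_cons i s : Hwords (i :: s) = Hword i ++ Hwords s.
Proof. by []. Qed.

Lemma Hwords_shift i s : Hwords (map (addn i) s) = shift i (Hwords s).
Proof.
by elim: s => [//|j s IHs]; rewrite [map _ _]/= !Hwords_cons shift_cat IHs.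
Qed.

Lemma Hrow_shift i p r : map (addn i) (Hrow p r) = Hrow (i + p) r.
Proof. by rewrite /Hrow -map_comp; apply: eq_map => k /=; rewrite addnA. Qed.

Lemma lower_shift i p j : map (addn i) (lower p j) = lower (i + p) j.
Proof. by elim: j p => //= j IHj p; rewrite map_cat IHj Hrow_shift !addnS. Qed.

Lemma upper_shift i p j : map (addn i) (upper p j) = upper (i + p) j.
Proof. by elim: j p => //= j IHj p; rewrite map_cat IHj Hrow_shift !addnS. Qed.

Lemma diamond_shift i p j : map (addn i) (diamond p j) = diamond (i + p) j.
Proof. by rewrite /diamond !map_cat lower_shift upper_shift Hrow_shift. Qed.

Lemma run_Hwords N s : all (fun i => i.+1 < N) s -> run (ups N) (Hwords s) = Some (ups N).
Proof.
elim: s => [|i s IHs] //= /andP[hi /IHs hs].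
by rewrite Hwords_cons run_cat (eqP (is_web_Hword hi)).
Qed.

Lemma Hrow_bound p r : all (fun i => i.+1 < p + r.*2) (Hrow p r).
Proof. by apply/allP=> i /mapP[k]; rewrite mem_iota => hk ->; lia. Qed.

Lemma lower_bound p j : all (fun i => i.+1 < p + j.*2) (lower p j).
Proof.
elim: j p => //= j IHj p; rewrite all_cat; apply/andP; split.
  by apply: sub_all (IHj p.+1) => i; lia.
by apply: sub_all (Hrow_bound p.+1 j) => i; lia.
Qed.

Definition merges j : word := [seq (i, Merge true) | i <- iota 0 j].
Definition splits j : word := [seq (i.*2, Split false) | i <- iota 0 j].

Lemma mergesS j : merges j.+1 = (0, Merge true) :: shift 1 (merges j).
Proof.
rewrite /merges /= -[1]/(1 + 0) iotaDl -map_comp /shift -map_comp; congr cons.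
Qed.

Lemma splitsS j : splits j.+1 = (0, Split false) :: shift 2 (splits j).
Proof.
rewrite /splits /= -[1]/(1 + 0) iotaDl -map_comp /shift -map_comp; congr cons.
Qed.

Lemma run_merges j : run (ups j.*2) (merges j) = Some (nseq j false).
Proof.
have := @is_web_merges_at [::] j [::]; rewrite !cats0 => /eqP <-; congr run.
Qed.

Lemma weq_refl p w : weq p w w.
Proof. by []. Qed.

(** Each splitting vertex is lowered to the merging vertex it forms an H
    with. *)
Lemma weq_merges_splits j : weq (ups j.*2) (merges j ++ splits j) (Hwords (Hrow 0 j)).
Proof.
elim: j => [|j IHj]; first exact: weq_refl.
rewrite mergesS splitsS HrowS -(Hrow_shift 2 0) Hwords_cons Hwords_shift.
have sl := @weq_slide (Split false) [::] _ _ _ (run_merges j).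
have hu : run (ups j.+1.*2) [:: (0, Merge true)] = Some ([:: false] ++ ups j.*2).
  rewrite doubleS.
  exact: (@run_shift [::] (ups j.*2) (ups 2) [:: false] [:: (0, Merge true)]).
apply: weq_trans.
  have := weq_right (shift 2 (splits j)) (weq_left hu (weq_sym sl)).
  by rewrite -!catA; apply.
have hu2 : run (ups j.+1.*2) (Hword 0) = Some (ups 2 ++ ups j.*2 ++ [::]).
  by rewrite cats0 doubleS (eqP (@is_web_Hword _ 0 _)).
have := weq_at [::] hu2 IHj; rewrite !cats0 !shift_cat; exact.
Qed.

Lemma ups_cons_rcons m : ups m.+2 = [:: true] ++ ups m ++ [:: true].
Proof. by rewrite ups_rcons. Qed.

Lemma weq_triangle_in j :
  weq (ups j.*2) (triangle_in j) (Hwords (lower 0 j) ++ merges j).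
Proof.
elim: j => [|j IHj]; first exact: weq_refl.
have -> : triangle_in j.+1 = shift 1 (triangle_in j) ++ shift 1 (splits j) ++ merges j.+1.
  by rewrite /= /splits /shift -map_comp.
rewrite -[lower 0 j.+1]/(lower 1 j ++ Hrow 1 j) -(lower_shift 1 0) -(Hrow_shift 1 0).
rewrite -map_cat Hwords_shift Hwords_cat.
rewrite catA; apply: weq_right.
rewrite doubleS ups_cons_rcons -shift_cat.
apply: (@weq_shift [:: true] [:: true]).
apply: weq_trans (weq_right (splits j) IHj) _.
rewrite -catA; apply: (@weq_left _ (Hwords (lower 0 j)) _ _ _ _ (@weq_merges_splits j)).
apply: run_Hwords; exact: lower_bound.
Qed.

Lemma weq_triangle_out j :
  weq (nseq j false) (triangle_out j) (splits j ++ Hwords (upper 0 j)).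
Proof.
elim: j => [|j IHj]; first exact: weq_refl.
have -> : triangle_out j.+1 =
    splits j.+1 ++ shift 1 (merges j) ++ shift 1 (triangle_out j).
  by rewrite /= /merges /shift -map_comp.
rewrite -[upper 0 j.+1]/(Hrow 1 j ++ upper 1 j) -(upper_shift 1 0) -(Hrow_shift 1 0).
rewrite -map_cat Hwords_shift Hwords_cat.
have hu : run (nseq j.+1 false) (splits j.+1) = Some ([:: true] ++ ups j.*2 ++ [:: true]).
  have := @is_web_splits_at [::] j.+1 [::]; rewrite !cats0 => /eqP.
  by rewrite -ups_cons_rcons -doubleS => <-; congr run.
apply: (weq_left hu); rewrite -shift_cat; apply: (@weq_shift [:: true] [:: true]).
apply: weq_trans (weq_left (run_merges j) IHj) _.
by rewrite catA; apply: weq_right (@weq_merges_splits j).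
Qed.

(** In the two triangles put on top of each other, each row of merging
    vertices is followed by the row of splitting vertices that continues its
    edges upwards, so all rows pair up to rows of H's. *)
Lemma weq_stem n k : k <= n -> weq (ups (n - k).*2)
  (triangle_in (n - k) ++ triangle_out (n - k)) (Hwords (diamond 0 (n - k))).
Proof.
move=> hk; set j := n - k.
apply: weq_trans (weq_right _ (@weq_triangle_in j)) _.
rewrite /diamond !Hwords_cat -!catA.
have hl : run (ups j.*2) (Hwords (lower 0 j)) = Some (ups j.*2).
  by apply: run_Hwords; exact: lower_bound.
apply: (weq_left hl).
apply: weq_trans (weq_left (run_merges j) (@weq_triangle_out j)) _.
by rewrite catA; apply: weq_right (@weq_merges_splits j).
Qed.

End Stem.

(** * Quantum integers *)

Section Scalars.

(** The recursion of quantum integers with q^(1/2) and its inverse as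
    variables. *)
Lemma qint_rec (F : fieldType) (a a' x x' d : F) : a * a' = 1 ->
  (a * (a * x) - a' * (a' * x')) / d =
  (a + a') * ((a * x - a' * x') / d) - (x - x') / d.
Proof.
move=> h; rewrite [X in _ = X - _]mulrA -mulrBl; congr (_ / d).
transitivity (a * (a * x) - a' * (a' * x') + (a * a' - 1) * (x - x')); last by ring.
by rewrite h subrr mul0r addr0.
Qed.

Lemma frac_X_neq0 : (tofrac ('X : {poly rat}) : K) != 0.
Proof. by rewrite tofrac_eq0 polyX_eq0. Qed.

Lemma q6D a b : q6 (a + b) = q6 a * q6 b.
Proof. by rewrite /q6 expfzDr // frac_X_neq0. Qed.

Lemma q6_0 : q6 0 = 1. Proof. exact: expr0z. Qed.

Lemma q6_nat k : q6 k%:Z = tofrac ('X^k : {poly rat}).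
Proof. by rewrite /q6 rmorphXn. Qed.

(** q^(1/6) is an indeterminate, hence no root of unity. *)
Lemma q6_neq1 k : (0 < k)%N -> q6 k%:Z != 1.
Proof.
move=> hk; rewrite q6_nat -(rmorph1 (@tofrac {poly rat})) tofrac_eq.
apply/eqP => /(congr1 (fun p : {poly rat} => size p)).
by rewrite size_polyXn size_poly1; lia.
Qed.

Lemma qpoch_neq0 k : poch (q6 6) k != 0.
Proof.
rewrite /poch prodf_seq_neq0; apply/allP=> i; rewrite mem_index_iota => /andP[hi _] /=.
rewrite subr_eq0 eq_sym (qX q6D q6_0) -PoszM q6_neq1 //; lia.
Qed.

Lemma q6_sub_neq0 k : (0 < k)%N -> q6 (3 * k%:Z) - q6 (- (3 * k%:Z)) != 0.
Proof.
move=> hk; rewrite subr_eq0; apply/eqP => h.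
have /eqP : q6 (3 * k%:Z) * q6 (3 * k%:Z) = 1.
  by rewrite {2}h -q6D subrr q6_0.
rewrite -q6D; apply/negP.
have -> : 3 * k%:Z + 3 * k%:Z = (6 * k)%N%:Z by rewrite PoszM; ring.
by apply: q6_neq1; lia.
Qed.

Lemma qint_neq0 k : qint k.+1 != 0.
Proof.
rewrite /qint mulf_neq0 ?q6_sub_neq0 // invr_eq0.
by have := @q6_sub_neq0 1 isT; rewrite mulr1.
Qed.

Lemma q6_3_neq0 : q6 3 - q6 (- 3) != 0.
Proof. by have := @q6_sub_neq0 1 isT; rewrite mulr1. Qed.

Lemma qint1 : qint 1 = 1.
Proof. by rewrite /qint mulr1 mulfV // q6_3_neq0. Qed.

Lemma qintS k : qint k.+2 = (q6 3 + (q6 3)^-1) * qint k.+1 - qint k.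
Proof.
rewrite /qint -(qN q6D q6_0).
have -> : q6 (3 * k.+2%:Z) = q6 3 * (q6 3 * q6 (3 * k%:Z)).
  by rewrite -!q6D; congr q6; rewrite !intS; ring.
have -> : q6 (- (3 * k.+2%:Z)) = q6 (- 3) * (q6 (- 3) * q6 (- (3 * k%:Z))).
  by rewrite -!q6D; congr q6; rewrite !intS; ring.
have -> : q6 (3 * k.+1%:Z) = q6 3 * q6 (3 * k%:Z).
  by rewrite -!q6D; congr q6; rewrite !intS; ring.
have -> : q6 (- (3 * k.+1%:Z)) = q6 (- 3) * q6 (- (3 * k%:Z)).
  by rewrite -!q6D; congr q6; rewrite !intS; ring.
by apply: qint_rec; rewrite -(q6D 3 (- 3)) subrr q6_0.
Qed.

Lemma qint2 : qint 2 = q6 3 + (q6 3)^-1.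
Proof.
rewrite qintS qint1 mulr1.
suff -> : qint 0 = 0 by rewrite subr0.
by rewrite /qint mulr0 oppr0 subrr mul0r.
Qed.

End Scalars.

(** * Twists and clasps as operators *)

Lemma crossing_lin (F : fieldType) (V : lmodType F) (b t c c' : F) (x y : V) :
  b * t = - c -> b = - c' -> c *: x - c' *: y = b *: (y - t *: x).
Proof.
by move=> h1 h2; rewrite scalerBr scalerA h1 h2 !scaleNr opprK addrC.
Qed.

Lemma linear_exp (F : fieldType) (V : lmodType F) (g : {linear V -> V}) (b : F) p q v :
  b ^+ p *: g (b ^+ q *: v) = b ^+ (p + q) *: g v.
Proof. by rewrite linearZ scalerA -exprD. Qed.

Lemma linear_expS (F : fieldType) (V : lmodType F) (g : {linear V -> V}) (b : F) q v :
  b *: g (b ^+ q *: v) = b ^+ q.+1 *: g v.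
Proof. by rewrite -[X in X *: g _]expr1 linear_exp. Qed.

Lemma rows_recl (R : pzRingType) (c : nat -> R) p n :
  \prod_(i < p.+1) \prod_(j < n) c (p.+1 - i.+1 + j)%N =
  \prod_(j < n) c (p + j)%N * \prod_(i < p) \prod_(j < n) c (p - i.+1 + j)%N.
Proof.
by rewrite big_ord_recl; congr (_ * _); apply: eq_bigr => j _; rewrite subSS subn0.
Qed.

Lemma linear_sum_mul (F : fieldType) (B : lalgType F) (V : lmodType F)
    (g : {linear B -> V}) (I : Type) (s : seq I) (c : I -> F) (x : I -> B) y :
  g ((\sum_(i <- s) c i *: x i) * y) = \sum_(i <- s) c i *: g (x i * y).
Proof.
by rewrite mulr_suml linear_sum; apply: eq_bigr => i _; rewrite -scalerAl linearZ.
Qed.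

Section Assembly.
Variables (n : nat) (pos : bool).
Local Notation N := (n + n)%N.
Local Notation a := (ups (n + n)).
Local Notation V := (web_space a a).
Local Notation cls := (web_class a a).
Definition Hop (i : nat) : {linear V -> V} := @hact a i.
Local Notation e := Hop.

Lemma Hop_class i f : e i (cls f) = cls (f * web (Hword i)).
Proof. exact: hact_class. Qed.

Lemma clsZ c f : cls (c *: f) = c *: cls f.
Proof. exact: linearZ. Qed.
Lemma clsB f g : cls (f - g) = cls f - cls g.
Proof. exact: linearB. Qed.
Lemma mulcB (f g h : comb) : f * (g - h) = f * g - f * h.
Proof. exact: mulrBr. Qed.
Lemma mulcZ c (f g : comb) : f * (c *: g) = c *: (f * g).
Proof. exact: esym (comb_scalerAr _ _ _). Qed.
Lemma mulcA (f g h : comb) : f * (g * h) = f * g * h.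
Proof. exact: mulrA. Qed.
Lemma mulc1 (f : comb) : f * 1 = f.
Proof. exact: mulr1. Qed.

Lemma cls_lin (f g : comb) c c' :
  cls (f * (c *: 1 - c' *: g)) = c *: cls f - c' *: cls (f * g).
Proof. by rewrite mulcB clsB; congr (_ - _); rewrite mulcZ clsZ ?mulc1. Qed.

(** q^(1/2) for positive and q^(-1/2) for negative crossings: both have the
    loop value [2], and the crossing is a scalar multiple of H_i minus this
    element. *)
Definition half_q : K := if pos then q6 3 else q6 (- 3).
Definition cross_id : K := if pos then q6 2 else q6 (- 2).
Definition cross_H : K := if pos then q6 (- 1) else q6 1.
Definition cross_scalar : K := - cross_H.

Lemma crossingE i : crossing pos i = cross_id *: 1 - cross_H *: web (Hword i).
Proof. by rewrite /cross_id /cross_H; case: pos. Qed.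

Lemma cross_scalarE : cross_scalar * half_q = - cross_id.
Proof. by rewrite mulNr /cross_H /half_q /cross_id; case: pos; rewrite -q6D. Qed.

Lemma half_q_neq0 : half_q != 0.
Proof. by rewrite /half_q; case: pos; apply: (q_neq0 q6D q6_0). Qed.

Lemma half_q_loop : half_q + half_q^-1 = qint 2.
Proof.
by rewrite qint2 /half_q; case: pos => //; rewrite (qN q6D q6_0 3) invrK addrC.
Qed.

Lemma cls_crossing f i :
  cls (f * crossing pos i) = cross_scalar *: cross half_q e i (cls f).
Proof.
rewrite crossingE cls_lin (crossing_lin _ _ cross_scalarE (erefl _)).
by rewrite -Hop_class -crossE.
Qed.

Lemma cls_sweep f p q :
  cls (f * \prod_(j < q) crossing pos (p + j)) =
  cross_scalar ^+ q *: sweep half_q e p q (cls f).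
Proof.
elim: q => [|q IHq]; first by rewrite big_ord0 mulr1 scale1r.
by rewrite big_ord_recr mulcA cls_crossing IHq sweepS; apply: linear_expS.
Qed.

Lemma cls_rows f p :
  cls (f * \prod_(i < p) \prod_(j < n) crossing pos (p - i.+1 + j)) =
  cross_scalar ^+ (p * n) *: shuffle half_q e (nseq p true ++ nseq n false) (cls f).
Proof.
have shuffle0 k v : shuffle half_q e (nseq k false) v = v by elim: k.
elim: p f => [|p IHp] f.
  by rewrite big_ord0 mulc1 mul0n scale1r [nseq 0 _ ++ _]/= shuffle0.
have -> : \prod_(i < p.+1) \prod_(j < n) crossing pos (p.+1 - i.+1 + j) =
    \prod_(j < n) crossing pos (p + j) *
    \prod_(i < p) \prod_(j < n) crossing pos (p - i.+1 + j).
  exact: rows_recl.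
have -> v : shuffle half_q e (nseq p.+1 true ++ nseq n false) v =
    shuffle half_q e (nseq p true ++ nseq n false) (sweep half_q e p n v).
  by rewrite /= !count_cat !count_nseq /= !mul1n !mul0n addn0.
by rewrite mulcA IHp cls_sweep linear_exp mulSn addnC.
Qed.

Lemma cls_half_twist f :
  cls (f * half_twist pos n) =
  cross_scalar ^+ (n * n) *: half_twist_op half_q e n (cls f).
Proof. exact: cls_rows. Qed.

Lemma cls_half_twists f r :
  cls (f * half_twist pos n ^+ r) =
  cross_scalar ^+ (n * n) ^+ r *: iter r (half_twist_op half_q e n) (cls f).
Proof.
elim: r f => [|r IHr] f; first by rewrite mulc1 scale1r.
rewrite exprSr mulcA cls_half_twist IHr iterS; exact: linear_expS.
Qed.

Lemma claspS i m : clasp i m.+2 = clasp i m.+1 - (qint m.+1 / qint m.+2) *: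
  (clasp i m.+1 * web (Hword (i + m)) * clasp i m.+1).
Proof. by []. Qed.

Lemma cls_clasp f i m : cls (f * clasp i m) = wenzl e qint i m (cls f).
Proof.
elim: m f => [|[|m] IHm] f; [by rewrite mulc1 | by rewrite mulc1 |].
rewrite claspS mulcB clsB mulcZ clsZ wenzlS; congr (_ - _ *: _); first exact: IHm.
by rewrite !mulcA (IHm (f * _ * _)) -Hop_class (IHm f).
Qed.

Lemma cls_clasps f : cls (f * clasps n) = wenzl2 e n qint (cls f).
Proof. by rewrite mulcA !cls_clasp. Qed.

Lemma Hop_loop i v : (i.+1 < N)%N -> e i (e i v) = (half_q + half_q^-1) *: e i v.
Proof. by move=> hi; rewrite half_q_loop; apply: hact_bigon. Qed.

Lemma Hop_braid i v : (i.+2 < N)%N ->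
  e i (e i.+1 (e i v)) - e i v = e i.+1 (e i (e i.+1 v)) - e i.+1 v.
Proof. exact: hact_braid. Qed.

Lemma Hop_far i j v : (i.+1 < j)%N -> (j.+1 < N)%N -> e i (e j v) = e j (e i v).
Proof. exact: hact_far. Qed.

Lemma qint2_half_q : qint 2 = half_q + half_q^-1. Proof. by rewrite half_q_loop. Qed.

Lemma qintS_half_q k : qint k.+2 = (half_q + half_q^-1) * qint k.+1 - qint k.
Proof. by rewrite half_q_loop qint2 qintS. Qed.

Local Notation Pr := (wenzl2 e n qint).
Definition clasped_id : V := Pr (cls 1).

Lemma clasped_id_killed : killed e n n clasped_id.
Proof.
exact: (wenzl2_killed half_q_neq0 Hop_loop Hop_braid Hop_far (leqnn N) qint_neq0 qint1
  qint2_half_q qintS_half_q).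
Qed.

Lemma clasp_kills i v : (i.+1 < N)%N -> i.+1 != n -> Pr (e i v) = 0.
Proof.
exact: (wenzl2_kills half_q_neq0 Hop_loop Hop_braid Hop_far (leqnn N) qint_neq0 qint1
  qint2_half_q qintS_half_q).
Qed.

Lemma clasped_idE : clasped_id = cls (clasps n).
Proof. by rewrite /clasped_id -cls_clasps mul1r. Qed.

Lemma cls_twist r : cls (clasps n * half_twist pos n ^+ r * clasps n) =
  cross_scalar ^+ (n * n) ^+ r *:
  clasped_diamond e n Pr n (iter r (half_twist_op half_q e n) clasped_id).
Proof.
by rewrite cls_clasps cls_half_twists -clasped_idE linearZ /clasped_diamond subnn.
Qed.

Lemma cls_eact f s : cls (f * web (Hwords s)) = eact e s (cls f).
Proof.
elim: s f => [|i s IHs] f; first exact: (congr1 cls (mulc1 f)).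
by rewrite Hwords_cons -webM mulcA IHs -Hop_class.
Qed.

(** weq speaks of what is drawn above a single web; this extends it to a
    linear combination f of webs. *)
Lemma cls_weq f x p y l r : a = x ++ p ++ y -> weq p l r -> web_comb a a f ->
  cls (f * web (shift (size x) l)) = cls (f * web (shift (size x) r)).
Proof.
move=> Ea h [s -> hs].
have E g : cls ((\sum_(cw <- s) cw.1 *: web cw.2) * g) =
    \sum_(cw <- s) cw.1 *: cls (web cw.2 * g) by exact: linear_sum_mul.
apply: etrans (E _) (etrans _ (esym (E _))).
apply: eq_big_seq => cw /(allP hs) hw; apply: congr1.
rewrite !webM; have := h a a cw.2 x y [::]; rewrite !cats0; apply.
by rewrite -Ea; apply: run_web.
Qed.

Lemma cls_Dweb k : (k <= n)%N -> cls (Dweb n k) = clasped_diamond e n Pr k clasped_id.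
Proof.
move=> hk; rewrite /Dweb cls_clasps /clasped_diamond clasped_idE; congr (Pr _).
have Ea : a = ups k ++ ups (n - k).*2 ++ ups k.
  by rewrite /ups -!nseqD; congr nseq; lia.
have hs : stem n k = shift (size (ups k)) (triangle_in (n - k) ++ triangle_out (n - k)).
  by rewrite size_nseq.
move: (clasps n) (web_comb_clasps n) => c hc.
rewrite hs (cls_weq Ea (@weq_stem n k hk) hc).
have -> : shift (size (ups k)) (Hwords (diamond 0 (n - k))) = Hwords (diamond k (n - k)).
  by rewrite size_nseq -Hwords_shift diamond_shift addn0.
exact: cls_eact.
Qed.

End Assembly.

Lemma chi_posE n ks : path geq n ks ->
  cross_scalar true ^+ (n * n) ^+ size ks *
  chain (twist_coef (half_q true) n) n ks = chi_pos n ks.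
Proof. exact: (chain_pos q6D q6_0 qpoch_neq0). Qed.

Lemma chi_negE n ks : path geq n ks ->
  cross_scalar false ^+ (n * n) ^+ size ks *
  chain (twist_coef (half_q false) n) n ks = chi_neg n ks.
Proof. exact: (chain_neg q6D q6_0 qpoch_neq0). Qed.

Lemma path_geq_last k ks : path geq k ks -> (last k ks <= k)%N.
Proof.
by elim: ks k => //= l ks IHks k /andP[hl /IHks h]; apply: leq_trans h hl.
Qed.

(** The sum over chains of clasped_diamond_twists, started at k = n where
    the diamond is empty. *)
Lemma twist_expansion (n r : nat) (pos : bool) (chi : seq nat -> K) :
  (forall ks, path geq n ks ->
     cross_scalar pos ^+ (n * n) ^+ size ks *
     chain (twist_coef (half_q pos) n) n ks = chi ks) ->
  web_class (ups (n + n)) (ups (n + n)) (clasps n * half_twist pos n ^+ r * clasps n) =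
  \sum_(k : r.-tuple 'I_n.+1 | path geq n (kseq k))
     chi (kseq k) *: web_class (ups (n + n)) (ups (n + n)) (Dweb n (last n (kseq k))).
Proof.
move=> hchi; apply: etrans (cls_twist n pos r) _.
have h := clasped_diamond_twists (half_q_neq0 pos) (@Hop_loop n pos) (@Hop_braid n) (@Hop_far n)
  (leqnn _) (@clasp_kills n pos) r (@clasped_id_killed n pos) (leqnn n).
apply: etrans (congr1 _ h) _.
apply: etrans (scaler_sumr _ _ _ _) _.
apply: eq_bigr => ks hks; apply: etrans (scalerA _ _ _) _.
have hD : web_class (ups (n + n)) (ups (n + n)) (Dweb n (last n (kseq ks))) =
    clasped_diamond (@Hop n) n (wenzl2 (@Hop n) n qint) (last n (kseq ks)) (clasped_id n).
  by apply: cls_Dweb; apply: path_geq_last.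
rewrite hD; congr (_ *: _).
by rewrite -(hchi _ hks) size_map size_tuple.
Qed.

(** * The expansion of the twists *)

Theorem proposition3p1 (n : nat) (m : int) (hn : (0 < n)%N) (hm : m != 0) :
  (0 < m ->
    ribbon_class n (twist n m) =
    \sum_(k : `|m|%N.-tuple 'I_n.+1 | path geq n (kseq k))
       chi_pos n (kseq k) *: ribbon_class n (Dweb n (last n (kseq k)))) /\
  (m < 0 ->
    ribbon_class n (twist n m) =
    \sum_(k : `|m|%N.-tuple 'I_n.+1 | path geq n (kseq k))
       chi_neg n (kseq k) *: ribbon_class n (Dweb n (last n (kseq k)))).
Proof.
split=> hm0; rewrite /twist.
  rewrite hm0.
  exact: (@twist_expansion n `|m|%N true (chi_pos n) (@chi_posE n)).
have -> : (0 < m) = false by apply/negbTE; lia.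
exact: (@twist_expansion n `|m|%N false (chi_neg n) (@chi_negE n)).
Qed.
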